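(* Let $S$ be a finite set of places of $\mathbb{Q}$ containing the archimedean place, and let $\varphi(z)=z^2$. Let $\alpha,\beta\in\mathbb{Q}$ with $\alpha,\beta$ both non-preperiodic for $\varphi$. Then $$\left|\{n\geq 0\mid \varphi^n(\alpha)\text{ is }S\text{-integral relative to }\beta\}\right|\leq 3|S|+12\log_2|S|+50.$$
   Context: Two points $x,y\in\mathbb{P}^1(\mathbb{Q})$ are $S$-integral relative to each other if for every prime $p\notin S$ their reductions in $\mathbb{P}^1(\mathbb{F}_p)$ are distinct. A point is preperiodic for $z^2$ if its forward orbit is finite (for rationals: $0,\pm1$). *)

(* Defs.v *)
From HB Require Import structures.
From mathcomp Require Import all_boot all_order all_algebra finmap.
From mathcomp Require Import all_classical all_reals all_analysis.
Set Implicit Arguments.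
Unset Strict Implicit.
Unset Printing Implicit Defensive.
Import Order.TTheory GRing.Theory Num.Theory.
Local Open Scope ring_scope.

(* Places of Q, enumerated through Ostrowski's theorem: the archimedean
   place and one place for each prime number. *)
Definition place : choiceType := option {p : nat | prime p}.
Definition archimedean : place := None.
Definition finite_place (p : {p : nat | prime p}) : place := Some p.

(* P^1(F) = F + {oo}: Some x stands for [x : 1] and None for [1 : 0]. *)
Definition P1 (F : fieldType) : eqType := option F.
Definition affine (F : fieldType) (x : F) : P1 F := Some x.
Definition infty (F : fieldType) : P1 F := None.

(* The point [a : b], meaningful for (a, b) <> (0, 0). *)
Definition homog (F : fieldType) (a b : F) : P1 F :=
  if b == 0 then infty F else affine (a / b).

(* Coprime integer homogeneous coordinates of a point of P^1(Q). *)
Definition prim_coords (x : P1 rat) : int * int :=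
  if x is Some q then (numq q, denq q) else (1, 0).

Definition reduction (p : nat) (x : P1 rat) : P1 'F_p :=
  let: (a, b) := prim_coords x in homog (a%:~R : 'F_p) (b%:~R : 'F_p).

Definition S_integral (S : {fset place}) (x y : P1 rat) : Prop :=
  forall p : {p : nat | prime p}, finite_place p \notin S ->
    reduction (val p) x != reduction (val p) y.

(* z |-> z^2 as a self-map of P^1; it fixes oo. *)
Definition sqmap (x : P1 rat) : P1 rat :=
  if x is Some z then affine (z ^+ 2) else infty rat.

Definition preperiodic (T : Type) (f : T -> T) (x : T) : Prop :=
  finite_set (range (fun n : nat => iter n f x)).

Definition log2 (R : realType) (x : R) : R := ln x / ln 2.

(* Main.v *)
Require Import Defs.
From mathcomp Require Import all_boot all_order all_algebra finmap.
From mathcomp Require Import all_classical all_reals all_analysis.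
From mathcomp Require Import perm zify ring lra.
Import Order.TTheory GRing.Theory Num.Theory.
Set Implicit Arguments.
Unset Strict Implicit.
Unset Printing Implicit Defensive.
(** Write alpha = a/b and beta = c/d in lowest terms, put H = max(|a|,|b|),
    G = max(|c|,|d|), q = |S| and N_n = a^(2^n) d - c b^(2^n).  The index n is
    counted iff every prime factor of N_n lies in S, so that one prime p of S
    satisfies p^(q v_p(N_n)) >= |N_n|; for all but two of the n >= 1, |N_n| has
    its expected archimedean size.

    If H^(2^n) is smaller than about G^(1/q), two indices n < m with the same
    dominating p are impossible: eliminating beta from the two congruences puts a
    power of p larger than H^(2^m) into a^W - b^W, W = 2^m - 2^n.  The range
    G^(1/q) << H^(2^n) << G^(1024 q^2) contains only log_2(4096 q^3) + 1 indices.
    Above it no prime dominates three indices n1 < n2 < n3.  Indeed, eliminating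
    alpha puts large powers of p into beta^u - 1 for u = 2^(n2-n1) - 1 and
    u = 2^(n3-n2) - 1, and lifting the exponent forces n3 to be exponentially
    larger than n2.  All heights and the order of alpha mod p are then polynomial
    in n3, while alpha^(2^n3) is p-adically within 2^(-2^n3/q) of beta, which
    contradicts a crude lower bound for p-adic linear forms in two logarithms.
    The latter comes from Laurent's interpolation determinants: with
    z = r + M s and M = 2^n3, the functions z^k alpha^(l z) take, up to the error
    of the approximation, the rational values z^k (alpha^r beta^s)^l; the
    determinant of such values is nonzero by a zero estimate, highly divisible by
    p by p-adic interpolation, and too small for that. *)

Local Open Scope ring_scope.

(** * Zero estimate *)

(** The [d i] are degree bounds that need not be attained; only the product of the coefficients at
    the bounds reaches degree [\sum d i]. *)
Lemma coef_prod_top (R : idomainType) (I : eqType) (r : seq I)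
    (p : I -> {poly R}) (d : I -> nat) :
  (forall i, (size (p i) <= (d i).+1)%N) ->
  (size (\prod_(i <- r) p i)%R <= (\sum_(i <- r) d i).+1)%N /\
  (\prod_(i <- r) p i)`_(\sum_(i <- r) d i) = \prod_(i <- r) (p i)`_(d i).
Proof.
move=> hp; elim: r => [|i r [IHs IHc]].
  by rewrite !big_nil size_poly1 coefC eqxx.
rewrite !big_cons; have hi := hp i; split.
  by apply: leq_trans (size_polyMleq _ _) _; lia.
rewrite coefM -IHc.
have lt_di : (d i < (d i + \sum_(j <- r) d j).+1)%N by lia.
rewrite (bigD1 (Ordinal lt_di)) //= addKn [X in _ + X]big1 ?addr0 // => j neq_j.
have [lt_ij|le_ji] := ltnP (d i) j.
  by rewrite (nth_default _ (leq_trans hi lt_ij)) mul0r.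
have lt_ji : (j < d i)%N.
  by rewrite ltn_neqAle le_ji andbT; apply: contra neq_j => /eqP ?; apply/eqP/val_inj.
rewrite [X in _ * X]nth_default ?mulr0 //.
by apply: leq_trans IHs _; rewrite -addnBAC ?(ltnW lt_ji) // -addn1 addnC leq_add2r subn_gt0.
Qed.

(** Each Leibniz term takes one entry from every column, so column-wise degree bounds have the same
    total for all permutations. *)
Lemma det_poly_top (R : idomainType) (m : nat) (A : 'M[{poly R}]_m)
    (d : 'I_m -> nat) :
  (forall i j, (size (A i j) <= (d j).+1)%N) ->
  (size (\det A)%R <= (\sum_j d j).+1)%N /\
  (\det A)`_(\sum_j d j) = \det (\matrix_(i, j) (A i j)`_(d j)).
Proof.
move=> hA; rewrite -det_tr.
have htop (s : 'S_m) := @coef_prod_top R _ (index_enum 'I_m)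
  (fun j => A (s j) j) d (fun j => hA (s j) j).
rewrite -[in RHS]det_tr /determinant; split.
  apply/(leq_trans (size_sum _ _ _))/bigmax_leqP => s _.
  rewrite mulr_sign.
  have -> : \prod_i A^T i (s i) = \prod_j A (s j) j.
    by apply: eq_bigr => j _; rewrite mxE.
  by case: odd_perm; rewrite ?size_polyN; case: (htop s).
rewrite coef_sum; apply: eq_bigr => s _.
have -> : \prod_i A^T i (s i) = \prod_j A (s j) j.
  by apply: eq_bigr => j _; rewrite mxE.
have -> : \prod_i (\matrix_(i, j) (A i j)`_(d j))^T i (s i)
    = \prod_j (A (s j) j)`_(d j).
  by apply: eq_bigr => j _; rewrite !mxE.
rewrite -(proj2 (htop s)) !mulr_sign.
by case: odd_perm; rewrite ?coefN.
Qed.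

(* After translating by (i, x^i), a common zero (z, w) with w <> 0 makes the square
   matrix (Q_l(z + i) x^(i l)) over the nonzero Q_l singular.  Its determinant is a
   polynomial in z of degree less than K L whose top coefficient is a Vandermonde
   determinant in the x^l, hence it has too many zeros. *)
Lemma zero_estimate (K L M rho : nat) (x y : rat) (Q : 'I_L -> {poly rat}) :
  x != 0 -> y != 0 -> injective (fun i : nat => x ^+ i) ->
  (rho <= M)%N -> (K * L <= rho * rho)%N ->
  (forall l, (size (Q l) <= K)%N) ->
  (forall r s, (r < rho + L)%N -> (s < rho)%N ->
     \sum_l (Q l).[(r + M * s)%:R] * (x ^+ r * y ^+ s) ^+ l = 0) ->
  forall l, Q l = 0.
Proof.
move=> x0 y0 xinj le_rhoM leKL szQ vanish.
(* Keeping only the nonzero [Q l] as columns makes every leading coefficient below nonzero. *)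
pose A := [set l | Q l != 0].
suff A0 : #|A| = 0%N.
  move=> l; apply/eqP/negPn/negP => Ql.
  by have := cards0_eq A0 => /setP/(_ l); rewrite !inE Ql.
apply/eqP; rewrite -leqn0 leqNgt; apply/negP => A_gt0.
set m := #|A| in A_gt0 *.
pose e (j : 'I_m) : 'I_L := enum_val j.
have eQ j : Q (e j) != 0 by have := enum_valP j; rewrite inE.
have le_mL : (m <= L)%N by rewrite -[leqRHS]card_ord max_card.
pose B : 'M[{poly rat}]_m := \matrix_(i, j)
  ((Q (e j) \Po ('X + (i%:R)%:P)) * ((x ^+ i) ^+ (e j))%:P).
pose d j := (size (Q (e j))).-1.
have szX (i : nat) : size ('X + (i%:R)%:P : {poly rat}) = 2.
  by rewrite size_XaddC.
have szB i j : (size (B i j) <= (d j).+1)%N.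
  rewrite mxE [_ * _]mulrC mul_polyC. apply: leq_trans (size_scale_leq _ _) _.
  by rewrite size_comp_poly2 ?szX // /d prednK // lt0n size_poly_eq0.
have [szD topD] := det_poly_top szB.
have D0 : \det B != 0.
  apply/eqP => D0; move: topD; rewrite D0 coef0 => /esym/eqP; apply/negP.
  have -> : \matrix_(i, j) (B i j)`_(d j) =
      Vandermonde m (\row_j (x ^+ (e j))) *m diag_mx (\row_j lead_coef (Q (e j))).
    apply/matrixP => i j; rewrite mul_mx_diag !mxE mulrC mul_polyC coefZ.
    rewrite -!exprM mulnC; congr (_ * _).
    have -> : d j = (size (Q (e j) \Po ('X + (i%:R)%:P))).-1.
      by rewrite size_comp_poly2 ?szX.
    rewrite -lead_coefE lead_coef_comp ?szX //.
    by rewrite lead_coefXaddC expr1n mulr1.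
  rewrite det_mulmx det_diag det_Vandermonde mulf_neq0 //.
    apply/prodf_neq0 => i _; apply/prodf_neq0 => j lt_ij.
    rewrite !mxE subr_eq0; apply/eqP => /xinj/val_inj/enum_val_inj ji.
    by rewrite ji ltnn in lt_ij.
  by apply/prodf_neq0 => i _; rewrite mxE lead_coef_eq0.
(* The base [rho] digits of [t] run through the pairs [(r, s)]. Since [rho <= M], the numbers
   [r + M s] are distinct, which yields [rho ^ 2] roots. *)
pose z (t : nat) : rat := (t %% rho + M * (t %/ rho))%:R.
have rho_gt0 : (0 < rho)%N.
  rewrite lt0n; apply/eqP => rho0; move: leKL; rewrite rho0 leqn0 muln_eq0.
  case/orP => /eqP h0; last by move: le_mL; rewrite h0; lia.
  have := szQ (e (Ordinal A_gt0)); rewrite h0 leqn0 size_poly_eq0.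
  by apply/negP.
have lt_s t : (t < rho * rho)%N -> (t %/ rho < rho)%N by rewrite ltn_divLR.
have zroot t : (t < rho * rho)%N -> root (\det B) (z t).
  move=> lt_t; have lt_r : (t %% rho < rho)%N by rewrite ltn_pmod.
  rewrite /root -[_.[z t]]/(horner_eval (z t) (\det B)) -det_map_mx -det_tr.
  apply/det0P; exists (\row_j (x ^+ (t %% rho) * y ^+ (t %/ rho)) ^+ (e j)).
    apply/eqP => /rowP/(_ (Ordinal A_gt0)); rewrite !mxE => /eqP.
    by apply/negP; rewrite expf_neq0 // mulf_neq0 ?expf_neq0.
  apply/rowP => i; rewrite !mxE.
  (* Row [i] uses the vanishing at [(r + i, s)]; this is why [r] ranges up to [rho + L] in the
     hypothesis. *)
  have lt_ri : (t %% rho + i < rho + L)%N.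
    have := ltn_ord i; lia.
  rewrite -[RHS](vanish _ _ lt_ri (lt_s _ lt_t)).
  rewrite [RHS](bigID (mem A)) /= [X in _ + X]big1 ?addr0; last first.
    by move=> l; rewrite inE negbK => /eqP ->; rewrite horner0 mul0r.
  rewrite [RHS]big_enum_val /=; apply: eq_bigr => j _; rewrite !mxE.
  rewrite /horner_eval hornerM hornerC horner_comp hornerD hornerX hornerC.
  rewrite mulrC -mulrA -exprMn mulrA -exprD addnC.
  by congr (_.[_] * _); rewrite /z -natrD; congr _%:R; lia.
have szr : (size [seq z t | t <- iota 0 (rho * rho)] < size (\det B)%R)%N.
  apply: max_poly_roots D0 _ _.
    by apply/allP => _ /mapP[t + ->]; rewrite mem_iota => /zroot.
  rewrite map_inj_in_uniq ?iota_uniq // => t u _ _ /eqP.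
  rewrite /z eqr_nat => /eqP eq_z.
  have := divn_eq t rho; have := divn_eq u rho.
  have := ltn_pmod t rho_gt0; have := ltn_pmod u rho_gt0.
  set a := (t %% rho)%N in eq_z *; set b := (u %% rho)%N in eq_z *.
  set f := (t %/ rho)%N in eq_z *; set g := (u %/ rho)%N in eq_z *.
  move=> ltb lta -> ->.
  suff : f = g by move=> fg; move: eq_z; rewrite fg; lia.
  clearbody a b f g; nia.
rewrite size_map size_iota in szr.
have sumd : (\sum_j d j <= m * K.-1)%N.
  rewrite -[m in leqRHS]card_ord -sum_nat_const; apply: leq_sum => j _.
  by rewrite /d -!subn1 leq_sub2r.
have K_gt0 : (0 < K)%N.
  apply: leq_trans (szQ (e (Ordinal A_gt0))).
  by rewrite lt0n size_poly_eq0.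
have lt_m : (m * K.-1 < K * L)%N.
  apply: (@leq_ltn_trans (L * K.-1)); first by rewrite leq_mul2r le_mL orbT.
  by rewrite mulnC ltn_pmul2r ?ltn_predL // (leq_trans A_gt0).
have : (rho * rho < (m * K.-1).+1)%N.
  by apply: leq_trans szr (leq_trans szD _); rewrite ltnS.
by rewrite ltnS leqNgt (leq_trans lt_m leKL).
Qed.

(** * Interpolation determinants *)

(** Induction removing an element [x >= n], which exists because [n + 1] distinct naturals cannot
    all lie below [n]. *)
Lemma sum_uniq_ge (g : nat -> nat) (s : seq nat) :
  {homo g : i j / (i <= j)%N} -> uniq s ->
  (\sum_(i < size s) g i <= \sum_(x <- s) g x)%N.
Proof.
move=> gmono; move def_n: (size s) => n.
elim: n s def_n => [|n IHn] s sz_s uniq_s; first by rewrite big_ord0.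
have [x xs le_nx] : exists2 x, x \in s & (n <= x)%N.
  apply/hasP/negPn/negP => /hasPn no_big.
  have /(uniq_leq_size uniq_s) : {subset s <= iota 0 n}.
    by move=> x /no_big; rewrite mem_iota -ltnNge.
  by rewrite size_iota sz_s ltnn.
rewrite (perm_big _ (perm_to_rem xs)) big_cons big_ord_recr /= addnC.
apply: leq_add; first exact: gmono.
by apply: IHn; rewrite ?rem_uniq // size_rem // sz_s.
Qed.

Lemma dvdz_exp_sub (p : int) (m n : nat) (x : int) :
  (m <= n)%N -> (p ^+ n %| x)%Z -> (p ^+ m %| x)%Z.
Proof. by move=> le_mn; apply/dvdz_trans/dvdz_exp2l. Qed.

(** Expansion in the style of Cauchy-Binet, over maps [f] into the inner indices. If [f] is not
    injective, its minor has two equal rows and vanishes; otherwise [f] takes [N] distinct values,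
    which cost at least as many factors [p] as [0, ..., N - 1]. *)
Lemma dvdz_det_mul (p : int) (K N Z : nat) (Phi : 'M[int]_(N, Z))
    (C : 'M[int]_(Z, N)) :
  (forall i j, (p ^+ (i - K) %| C i j)%Z) ->
  (p ^+ (\sum_(i < N) (i - K))%N %| \det (Phi *m C))%Z.
Proof.
move=> pC; rewrite -det_tr.
have -> : \det (Phi *m C)^T = \sum_(f : {ffun 'I_N -> 'I_Z})
    (\prod_j C (f j) j) * \det (\matrix_(j, i) Phi i (f j)).
  under [RHS]eq_bigr do rewrite big_distrr /=.
  rewrite exchange_big; apply: eq_bigr => s _ /=.
  under eq_bigr do rewrite !mxE.
  rewrite bigA_distr_bigA big_distrr /=; apply: eq_bigr => f _.
  rewrite big_split /= [RHS]mulrCA; congr (_ * _).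
  by rewrite mulrC; congr (_ * _); apply: eq_bigr => j _; rewrite mxE.
apply: rpred_sum => f _.
have [finj|] := boolP (injectiveb f); last first.
  move=> /injectivePn[i [j neq_ij eq_f]].
  rewrite [\det _](determinant_alternate neq_ij) ?mulr0 ?dvdz0 // => k.
  by rewrite !mxE eq_f.
apply: dvdz_mulr; apply: (@dvdz_exp_sub _ _ (\sum_j (f j - K))).
  have mono : {homo (fun i => i - K)%N : i j / (i <= j)%N}.
    by move=> i j; apply: leq_sub2r.
  have := @sum_uniq_ge _ [seq val (f j) | j <- enum 'I_N] mono.
  rewrite size_map -cardE card_ord big_map big_enum; apply.
  rewrite map_inj_uniq ?enum_uniq // => i j /val_inj.
  exact: (injectiveP _ finj).
rewrite expr_sum; apply: (big_ind2 (fun x y => (x %| y)%Z)) => //.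
by move=> x1 x2 y1 y2; apply: dvdz_mul.
Qed.

(** For [k = 0] this is the binomial expansion of [(y0 + (y - y0)) ^ z]. A further factor [z] is
    absorbed by [z C(z, i) = i C(z, i) + (i + 1) C(z, i + 1)], which shifts the index by at most one
    and so loses at most one power of [p]. *)
Lemma newton_expansion (p y y0 : int) (k : nat) : (p %| y - y0)%Z ->
  exists2 C : nat -> int, forall i, (p ^+ (i - k) %| C i)%Z &
    forall z : nat, (z%:R ^+ k) * y ^+ z =
      \sum_(i < z.+1) y0 ^+ (z - i) * C i *+ 'C(z, i).
Proof.
move=> py; elim: k => [|k [C pC CE]].
  exists (fun i => (y - y0) ^+ i) => [i|z].
    by rewrite subn0 dvdz_exp2r.
  by rewrite expr0 mul1r -exprDn addrC subrK.
exists (fun i => (C i + (if i is j.+1 then y0 * C j else 0)) *+ i) => [i|z].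
  rewrite -mulr_natr dvdz_mulr // rpredD //.
    by apply: dvdz_exp_sub (pC i); rewrite leq_sub2l.
  by case: i => [|i]; rewrite ?dvdz0 // dvdz_mull.
rewrite exprS -mulrA CE big_distrr /=.
have splitE (i : 'I_z.+1) : z%:R * (y0 ^+ (z - i) * C i *+ 'C(z, i)) =
   y0 ^+ (z - i) * C i *+ ('C(z, i) * i) +
   y0 ^+ (z - i) * C i *+ ('C(z, i.+1) * i.+1).
  rewrite -mulrnDr [X in _ *+ (_ + X)]mulnC mul_bin_left.
  by rewrite mulr_natl -mulrnA [X in (_ + X)%N]mulnC -mulnDr subnKC // -ltnS.
under eq_bigr do rewrite splitE.
rewrite big_split /= [X in _ + X]big_ord_recr /= bin_small // mul0n mulr0n addr0.
under [RHS]eq_bigr do rewrite mulrnAr -mulrnA mulrDr mulrnDl mulnC.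
rewrite big_split /=; congr (_ + _).
rewrite [RHS]big_ord_recl /= muln0 mulr0n add0r; apply: eq_bigr => i _.
by rewrite mulrA -exprSr /bump add1n subnSK.
Qed.

Lemma dvdz_det_sub (m : int) (N : nat) (A B : 'M[int]_N) :
  (forall i j, (m %| A i j - B i j)%Z) -> (m %| \det A - \det B)%Z.
Proof.
move=> mAB; apply: (big_ind2 (fun x y => (m %| x - y)%Z)) => [|x1 x2 y1 y2 h1 h2|s _] //.
  have -> : x1 + y1 - (x2 + y2) = (x1 - x2) + (y1 - y2) by ring.
  exact: rpredD.
rewrite -mulrBr dvdz_mull //.
apply: (big_ind2 (fun x y => (m %| x - y)%Z)) => [|x1 x2 y1 y2 h1 h2|i _] //.
have -> : x1 * y1 - x2 * y2 = (x1 - x2) * y1 + x2 * (y1 - y2) by ring.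
by apply: rpredD; [apply: dvdz_mulr | apply: dvdz_mull].
Qed.

Lemma det_norm_le (N : nat) (A : 'M[int]_N) (B : int) :
  (forall i j, `|A i j| <= B) -> `|\det A| <= N`!%:R * B ^+ N.
Proof.
move=> leAB; apply: le_trans (ler_norm_sum _ _ _) _.
have le_term (s : {perm 'I_N}) : true ->
    `|(-1) ^+ s * \prod_i A i (s i)| <= B ^+ N.
  move=> _; rewrite normrM normr_sign mul1r normr_prod.
  rewrite -[N in B ^+ N]card_ord -prodr_const; apply: ler_prod => i _.
  by rewrite normr_ge0 leAB.
apply: le_trans (ler_sum _ le_term) _.
by rewrite sumr_const cardT -cardE card_Sn mulr_natl.
Qed.

(* z^k ((a/b)^r (c/d)^s)^l at z = r + M s, multiplied by the common denominator
   b^(L r) d^(L s) of the row (r, s). *)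
Definition interp_entry (a b c d : int) (L M r s l k : nat) : int :=
  (r + M * s)%:R ^+ k *
  ((a ^+ l * b ^+ (L - l)) ^+ r * (c ^+ l * d ^+ (L - l)) ^+ s).

Definition interp_matrix (a b c d : int) (K L M R rho : nat)
    (pt : 'I_#|{: 'I_L * 'I_K}| -> 'I_R * 'I_rho) :
    'M[int]_#|{: 'I_L * 'I_K}| :=
  \matrix_(i, j) interp_entry a b c d L M (pt i).1 (pt i).2
    (enum_val j : 'I_L * 'I_K).1 (enum_val j : 'I_L * 'I_K).2.

(** A linear relation between the columns over the whole grid is a family [Q] as in [zero_estimate],
    hence trivial. The full matrix thus has independent columns, and some selection of rows is
    invertible. *)
Lemma interp_nonsingular (a b c d : int) (K L M rho : nat) :
  a != 0 -> b != 0 -> c != 0 -> d != 0 -> `|a| != `|b| ->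
  (rho <= M)%N -> (K * L <= rho * rho)%N ->
  exists pt : 'I_#|{: 'I_L * 'I_K}| -> 'I_(rho + L) * 'I_rho,
    \det (interp_matrix a b c d M pt) != 0.
Proof.
move=> a0 b0 c0 d0 neq_ab le_rho leKL.
pose x : rat := a%:~R / b%:~R; pose y : rat := c%:~R / d%:~R.
have intr0 (u : int) : u != 0 -> u%:~R != 0 :> rat by rewrite intr_eq0.
have x0 : x != 0 by rewrite mulf_neq0 ?invr_eq0 ?intr0.
have y0 : y != 0 by rewrite mulf_neq0 ?invr_eq0 ?intr0.
have xinj : injective (fun i : nat => x ^+ i).
  move=> i j /(congr1 Num.norm); rewrite !normrX.
  apply: ieexprIn; rewrite ?normr_gt0 // normf_div.
  apply: contra neq_ab => /eqP xeq1.
  rewrite -(eqr_int rat) !intr_norm; apply/eqP.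
  exact: divr1_eq xeq1.
pose E : 'M[rat]_(#|{: 'I_(rho + L) * 'I_rho}|, #|{: 'I_L * 'I_K}|) :=
  \matrix_(i, j) (interp_entry a b c d L M (enum_val i : 'I_(rho + L) * 'I_rho).1 (enum_val i : 'I_(rho + L) * 'I_rho).2
    (enum_val j : 'I_L * 'I_K).1 (enum_val j : 'I_L * 'I_K).2)%:~R.
have entryE r s l k : (l <= L)%N -> (interp_entry a b c d L M r s l k)%:~R =
    (r + M * s)%:R ^+ k * (x ^+ r * y ^+ s) ^+ l *
    ((b ^+ L) ^+ r * (d ^+ L) ^+ s)%:~R :> rat.
  move=> le_lL; rewrite /interp_entry !rmorphM /= !rmorphXn /= !rmorphM /=.
  rewrite !rmorphXn /= -mulrA rmorph_nat; congr (_ * _).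
  have splitX (u v : int) : v != 0 -> u%:~R ^+ l * v%:~R ^+ (L - l) =
      (u%:~R / v%:~R) ^+ l * v%:~R ^+ L :> rat.
    move=> v0; rewrite -[in RHS](subnKC le_lL) exprD mulrA -exprMn divfK //.
    by rewrite intr0.
  rewrite !splitX // -/x -/y !exprMn -!exprM ![(_ * l)%N]mulnC.
  by rewrite [LHS]mulrACA.
have full_E : row_full E.
  rewrite /row_full -mxrank_tr -/(row_free E^T).
  apply: inj_row_free => v vE.
  (* A kernel vector supplies the coefficients of the [Q l]; the default 0 is never read, since the
     polynomials stop below [K]. *)
  pose co (l : 'I_L) (k : nat) : rat :=
    if insub k is Some k' then v 0 (enum_rank (l, k')) else 0.
  pose Q l := \poly_(k < K) co l k.
  have Q0 : forall l, Q l = 0.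
    apply: (zero_estimate x0 y0 xinj le_rho leKL) => [l|r s lt_r lt_s].
      exact: size_poly.
    have /rowP/(_ (enum_rank (Ordinal lt_r, Ordinal lt_s))) := vE.
    rewrite !mxE => vE0.
    have : ((b ^+ L) ^+ r * (d ^+ L) ^+ s)%:~R != 0 :> rat.
      by rewrite intr0 // mulf_neq0 ?expf_neq0.
    move=> /mulIf; apply; rewrite mul0r -[RHS]vE0 mulr_suml.
    transitivity (\sum_(lk : 'I_L * 'I_K) v 0 (enum_rank (lk.1, lk.2)) *
        (interp_entry a b c d L M r s lk.1 lk.2)%:~R : rat).
      rewrite -(pair_bigA _ (fun l k => v 0 (enum_rank (l, k)) *
        (interp_entry a b c d L M r s l k)%:~R : rat)) /=.
      apply: eq_bigr => l _; rewrite horner_poly !mulr_suml.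
      apply: eq_bigr => k _; rewrite entryE; last by rewrite ltnW.
      by rewrite /co valK !mulrA.
    rewrite (reindex (fun j : 'I_#|{: 'I_L * 'I_K}| => enum_val j : 'I_L * 'I_K)) /=;
      last first.
      by exists enum_rank => ? _; rewrite ?enum_valK ?enum_rankK.
    by apply: eq_bigr => j _; rewrite !mxE -surjective_pairing enum_valK enum_rankK.
  apply/rowP => j; rewrite mxE -[j]enum_valK; case: (enum_val j) => l k.
  have /(congr1 (fun q : {poly rat} => q`_k)) := Q0 l.
  by rewrite coef_poly ltn_ord coef0 /co valK.
exists (fun i => enum_val (fullrankfun full_E i)).
have := fullrowsub_unit full_E; rewrite unitmxE unitfE.
have -> : rowsub (fullrankfun full_E) E = map_mx intr
    (interp_matrix a b c d M (fun i => enum_val (fullrankfun full_E i))).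
  by apply/matrixP => i j; rewrite !mxE.
by rewrite det_map_mx intr_eq0.
Qed.

Lemma normX_le (x B : int) (t : nat) : `|x| <= B -> `|x ^+ t| <= B ^+ t.
Proof.
move=> le_xB; have B_ge0 : 0 <= B by apply: le_trans le_xB.
by rewrite normrX lerXn2r ?nnegrE.
Qed.

(** Liouville's argument: the determinant is a nonzero integer, so a power of [p] dividing it cannot
    exceed the bound given by its entries. That power is limited by the quality [T] of the
    approximation and by the gain from interpolation, whence the minimum. *)
Lemma interpolation_bound (p : nat) (a b c d : int) (K L M rho T : nat) (B : int) :
  prime p -> (p %| a - b)%Z -> ~~ (p %| b)%Z ->
  a != 0 -> b != 0 -> c != 0 -> d != 0 -> `|a| != `|b| ->
  (rho <= M)%N -> (K * L <= rho * rho)%N ->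
  (p%:Z ^+ T %| a ^+ M * d - c * b ^+ M)%Z ->
  `|a| <= B -> `|b| <= B -> `|c| <= B -> `|d| <= B ->
  let N := (L * K)%N in
  p%:Z ^+ minn T (\sum_(i < N) (i - K))%N <=
    N`!%:R * ((rho + L + M * rho)%:R ^+ K * (B ^+ L) ^+ (rho + L + rho)) ^+ N.
Proof.
move=> p_pr p_ab p_b a0 b0 c0 d0 neq_ab le_rho leKL pT leaB lebB lecB ledB.
have [pt det0] := interp_nonsingular a0 b0 c0 d0 neq_ab le_rho leKL.
have cardN : #|{: 'I_L * 'I_K}| = (L * K)%N by rewrite card_prod !card_ord.
rewrite -cardN /=; set N := #|_| in pt det0 *; set e := minn _ _.
have B_ge0 : 0 <= B by apply: le_trans leaB.
have B_ge1 : 1 <= B.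
  by apply: le_trans leaB; rewrite -gtz0_ge1 normr_gt0.
set A := interp_matrix a b c d M pt in det0.
have leA i j : `|A i j| <=
    (rho + L + M * rho)%:R ^+ K * (B ^+ L) ^+ (rho + L + rho).
  rewrite mxE /interp_entry normrM; set r := (pt i).1; set s := (pt i).2.
  set l := (enum_val j : 'I_L * 'I_K).1; set k := (enum_val j : 'I_L * 'I_K).2.
  have leX (u v : int) (t : nat) : `|u| <= B -> `|v| <= B ->
      `|(u ^+ l * v ^+ (L - l)) ^+ t| <= (B ^+ L) ^+ t.
    move=> leu lev; apply: normX_le; rewrite normrM.
    rewrite -[L in B ^+ L](subnKC (ltnW (ltn_ord (enum_val j : 'I_L * 'I_K).1))).
    by rewrite exprD ler_pM ?normr_ge0 // normX_le.
  apply: ler_pM; rewrite ?normr_ge0 //.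
    rewrite normrX normr_nat; apply: (@le_trans _ _ ((rho + L + M * rho)%:R ^+ k)).
      rewrite lerXn2r ?nnegrE ?ler0n // ler_nat leq_add ?leq_mul2l //.
        exact: ltnW.
      by rewrite [(s <= _)%N]ltnW ?orbT.
    rewrite ler_weXn2l //; last exact: ltnW.
    by rewrite ler1n !addn_gt0 (leq_ltn_trans (leq0n s) (ltn_ord _)).
  rewrite normrM; apply: le_trans (ler_pM _ _ (leX a b r _ _) (leX c d s _ _)) _;
    rewrite ?normr_ge0 // -exprD ler_weXn2l ?exprn_ege1 //.
  by rewrite leq_add // ltnW.
have pA : (p%:Z ^+ e %| \det A)%Z.
  pose z i := ((pt i).1 + M * (pt i).2)%N.
  pose y (l : 'I_L) := a ^+ l * b ^+ (L - l).
  (* Since [a = b] modulo [p], all bases [y l] are expanded around the same centre [b ^+ L], so one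
     binomial matrix [Phi] serves all columns. *)
  have p_y l : (p %| y l - b ^+ L)%Z.
    rewrite -[L in b ^+ L](subnKC (ltnW (ltn_ord l))) exprD -mulrBl.
    by rewrite subrXX -mulrA dvdz_mulr.
  have [C pC CE] := fin_all_exists2 (fun j : 'I_N =>
    newton_expansion (enum_val j : 'I_L * 'I_K).2
      (p_y (enum_val j : 'I_L * 'I_K).1)).
  pose Phi : 'M[int]_(N, (rho + L + M * rho).+1) :=
    \matrix_(i, t) ((b ^+ L) ^+ (z i - t) *+ 'C(z i, t)).
  pose CM : 'M[int]_((rho + L + M * rho).+1, N) := \matrix_(t, j) C j t.
  have PhiCE i j : (Phi *m CM) i j =
      (z i)%:R ^+ (enum_val j : 'I_L * 'I_K).2 *
      y (enum_val j : 'I_L * 'I_K).1 ^+ z i.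
    have lt_z : ((z i).+1 <= (rho + L + M * rho).+1)%N.
      by rewrite ltnS leq_add ?leq_mul2l // ltnW // orbT.
    rewrite CE mxE (big_ord_widen _
      (fun t => (b ^+ L) ^+ (z i - t) * C j t *+ 'C(z i, t)) lt_z).
    rewrite [RHS]big_mkcond; apply: eq_bigr => t _; rewrite !mxE mulrnAl.
    by case: ltnP => // lt_zt; rewrite bin_small.
  have pF : (p%:Z ^+ e %| \det (Phi *m CM))%Z.
    apply: dvdz_exp_sub (geq_minr _ _) _; apply: dvdz_det_mul => i j.
    by rewrite mxE; apply: dvdz_exp_sub (pC j i); rewrite leq_sub2l // ltnW.
  (* These row factors clear the denominators on the two sides of the congruence. Only [D1] has to
     be cancelled, and its determinant is a power of [b], prime to [p]. *)
  pose D1 : 'rV[int]_N := \row_i b ^+ (L * M * (pt i).2).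
  pose D2 : 'rV[int]_N := \row_i d ^+ (L * (pt i).2).
  (* Modulo p^T one has c b^M = a^M d, which replaces (c/d)^s by (a/b)^(M s). *)
  have : (p%:Z ^+ e %| \det (diag_mx D1 *m A) -
      \det (diag_mx D2 *m (Phi *m CM)))%Z.
    apply: dvdz_exp_sub (geq_minl _ _) _; apply: dvdz_det_sub => i j.
    rewrite !mul_diag_mx mxE [X in _ - X]mxE PhiCE !mxE /interp_entry -/(z i).
    set k := (enum_val j : 'I_L * 'I_K).2.
    set l := (enum_val j : 'I_L * 'I_K).1; rewrite -/(y l).
    rewrite {2}/z exprD; set r := (pt i).1; set s := (pt i).2.
    rewrite !exprM -[(b ^+ L) ^+ M]exprM.
    set X := b ^+ (L * M) * (c ^+ l * d ^+ (L - l)).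
    set Y := d ^+ L * y l ^+ M.
    have -> : (b ^+ (L * M)) ^+ s * ((z i)%:R ^+ k *
        (y l ^+ r * (c ^+ l * d ^+ (L - l)) ^+ s)) -
        (d ^+ L) ^+ s * ((z i)%:R ^+ k * (y l ^+ r * (y l ^+ M) ^+ s)) =
        (z i)%:R ^+ k * y l ^+ r * (X ^+ s - Y ^+ s).
      by rewrite /X /Y !exprMn; ring.
    rewrite dvdz_mull // subrXX dvdz_mulr //.
    have le_lL : (l <= L)%N by rewrite ltnW.
    have -> : X - Y = (b ^+ M * d) ^+ (L - l) *
        ((c * b ^+ M) ^+ l - (a ^+ M * d) ^+ l).
      have -> : X = (b ^+ M) ^+ l * (b ^+ M) ^+ (L - l) * (c ^+ l * d ^+ (L - l)).
        by rewrite -exprD subnKC // -exprM mulnC.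
      have -> : Y = d ^+ l * d ^+ (L - l) * ((a ^+ M) ^+ l * (b ^+ M) ^+ (L - l)).
        by rewrite -exprD subnKC // /Y /y exprMn -!exprM ![(M * _)%N]mulnC.
      by rewrite !exprMn; ring.
    rewrite dvdz_mull // subrXX dvdz_mulr //.
    by rewrite -opprB rpredN.
  rewrite !det_mulmx.
  have p_det2 : (p%:Z ^+ e %| \det (diag_mx D2) * \det (Phi *m CM))%Z.
    by rewrite dvdz_mull.
  rewrite rpredBr //.
  rewrite Gauss_dvdzr // det_diag /D1.
  under eq_bigr do rewrite mxE.
  rewrite -expr_sum coprimezXl ?coprimezXr //.
  by rewrite coprimezE prime_coprime.
have normA_gt0 : (0 < `|\det A|)%N by rewrite absz_gt0.
apply: le_trans (det_norm_le leA).
rewrite -abszE -[p%:Z ^+ e]gez0_abs ?exprn_ge0 // lez_nat.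
exact: dvdn_leq.
Qed.

(** * A lower bound for p-adic linear forms in two logarithms *)

Lemma sum_subn_ge (K N : nat) :
  ((N - K) * (N - K).-1 <= (\sum_(i < N) (i - K)).*2)%N.
Proof.
elim: N => [|N IHN]; first by rewrite sub0n.
rewrite big_ord_recr /= doubleD; have [le_KN|lt_NK] := leqP K N; last first.
  by rewrite (eqP lt_NK).
by rewrite subSn //=; move: IHN; set t := (N - K)%N; case: t => [|t] /=; nia.
Qed.

(** The parameters make the interpolation gain [e0] exceed the logarithmic size [E] of the
    determinant. The minimum in [interpolation_bound] must then be [T], and
    [p ^ T <= 2 ^ E < 2 ^ e0] with [e0 <= N ^ 2 = rho ^ 4]. *)
Lemma power_approx_bound (p : nat) (a b c d : int) (n Y T : nat) :
  prime p -> (p %| a - b)%Z -> ~~ (p %| b)%Z ->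
  a != 0 -> b != 0 -> c != 0 -> d != 0 -> `|a| != `|b| ->
  (0 < n)%N -> (0 < Y)%N -> (1024 * n * Y <= 2 ^ n)%N ->
  `|a| <= 2 ^+ Y -> `|b| <= 2 ^+ Y -> `|c| <= 2 ^+ Y -> `|d| <= 2 ^+ Y ->
  (p%:Z ^+ T %| a ^+ (2 ^ n) * d - c * b ^+ (2 ^ n))%Z ->
  (p ^ T < 2 ^ ((1024 * n * Y) ^ 4))%N.
Proof.
move=> p_pr p_ab p_b a0 b0 c0 d0 neq_ab n_gt0 Y_gt0 le_rho leaB lebB lecB ledB pT.
set rho := (1024 * n * Y)%N in le_rho *.
(* L makes p^(N^2/2), the p-part of the determinant, beat the factors z^k, which are
   at most 2^(4 n K) per row; K is then large enough to beat the heights. *)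
set L := (32 * n)%N; set v := (32 * Y)%N; set K := (L * v ^ 2)%N.
have rhoE : rho = (L * v)%N by rewrite /rho /L /v; ring.
have NE : (L * K)%N = (rho ^ 2)%N by rewrite rhoE /K; ring.
have leKL : (K * L <= rho * rho)%N by rewrite mulnC NE.
have := interpolation_bound p_pr p_ab p_b a0 b0 c0 d0 neq_ab le_rho leKL pT
  leaB lebB lecB ledB.
set e0 := (\sum_(i < L * K) (i - K))%N; cbv zeta; set N := (L * K)%N.
(* Base 2 logarithm of the upper bound. Per row, [2 n] comes from [N! <= N ^ N] and
   [N <= 2 ^ (2 n)], [4 n K] from the powers of [z <= 2 ^ (4 n)], and the last term from the
   heights. *)
set E := (N * (2 * n + 4 * n * K + Y * L * (2 * rho + L)))%N.
have v_ge : (32 <= v)%N by rewrite /v leq_pmulr.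
have L_ge : (32 <= L)%N by rewrite /L leq_pmulr.
have K_gt0 : (0 < K)%N by rewrite /K muln_gt0 expn_gt0; lia.
(* With [N = 32 n K] one has [2 E <= 512 (n K) ^ 2], whereas [2 e0 >= (31 n K) (30 n K)]. *)
have lt_E : (E < e0)%N.
  have := sum_subn_ge K N; rewrite -/e0.
  have -> : (N - K = (32 * n).-1 * K)%N by rewrite /N /L -subn1 mulnBl mul1n.
  have S_le : (2 * n + 4 * n * K + Y * L * (2 * rho + L) <= 8 * n * K)%N.
    have : (Y * L * (2 * rho + L) <= 3 * n * K)%N.
      rewrite /K rhoE /L; have -> : (Y * (32 * n) = n * v)%N by rewrite /v; ring.
      clear -v_ge; nia.
    clear -K_gt0; nia.
  have : (E <= N * (8 * n * K))%N by rewrite leq_mul2l S_le orbT.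
  rewrite /N /L; clearbody E e0 K; clear -K_gt0 n_gt0.
  move=> h1; have : (31 * n <= (32 * n).-1)%N by lia.
  set m := (32 * n).-1 => le_m h2; clearbody m.
  have h3 : (31 * n * K <= m * K)%N by rewrite leq_mul2r le_m orbT.
  have h4 : (30 * n * K <= (m * K).-1)%N by nia.
  have := leq_mul h3 h4; nia.
have N_gt0 : (0 < N)%N by rewrite muln_gt0 K_gt0 andbT; clear -L_ge; lia.
have le_2E : (N`! * ((rho + L + 2 ^ n * rho) ^ K *
    ((2 ^ Y) ^ L) ^ (rho + L + rho)) ^ N <= 2 ^ E)%N.
  have -> : E = (2 * n * N + (4 * n * K + Y * L * (2 * rho + L)) * N)%N.
    by rewrite /E; ring.
  rewrite [leqRHS]expnD leq_mul //.
    have le_N : (N <= 2 ^ (2 * n))%N.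
      by rewrite /N NE mulnC expnM leq_exp2r.
    rewrite [leqRHS]expnM; apply: (@leq_trans (N ^ N)); last by rewrite leq_exp2r.
    rewrite fact_prod big_add1 /= big_mkord -[X in (_ <= _ ^ X)%N]card_ord.
    by rewrite -prod_nat_const leq_prod.
  rewrite [leqRHS]expnM leq_exp2r // [leqRHS]expnD leq_mul //.
    rewrite [leqRHS]expnM leq_exp2r //.
    have le_L : (L <= rho)%N by rewrite rhoE leq_pmulr // (leq_trans _ v_ge).
    have x_ge2 : (2 <= 2 ^ n)%N by rewrite -{1}[2%N]expn1 leq_exp2l.
    have -> : (2 ^ (4 * n) = 2 ^ n * 2 ^ n * (2 ^ n * 2 ^ n))%N.
      by rewrite -!expnD; congr (_ ^ _)%N; clear; lia.
    move: le_rho le_L x_ge2; set x := (2 ^ n)%N; clearbody x rho L; clear.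
    move=> h1 h2 h3; have : (x * rho <= x * x)%N by rewrite leq_mul2l h1 orbT.
    have : (4 <= x * x)%N by nia.
    set y := (x * x)%N; move=> h4 h5; have : (2 * x <= y)%N by rewrite leq_mul2r h3 orbT.
    nia.
  rewrite -!expnM leq_exp2l // -mulnA leq_mul2l leq_mul2l; do 2![apply/orP; right]; clear; lia.
move=> le_p.
have lt_2 : (2 ^ E < 2 ^ e0)%N by rewrite ltn_exp2l.
have le_e0 : (2 ^ e0 <= p ^ e0)%N.
  by case: (posnP e0) => [->|e0_gt0] //; rewrite leq_exp2r // prime_gt1.
have le_pm : (p ^ minn T e0 <= 2 ^ E)%N.
  rewrite -(ler_nat int) natrX natz (le_trans le_p) //.
  by move: le_2E; rewrite -(ler_nat int) natrM natrX natrM !natrX.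
have lt_T : (T < e0)%N.
  rewrite ltnNge; apply/negP => /minn_idPr min_e; move: le_pm.
  by rewrite min_e leqNgt (leq_trans lt_2).
move: le_pm; rewrite (minn_idPl (ltnW lt_T)) => le_pm.
apply: leq_ltn_trans le_pm (leq_trans lt_2 _).
rewrite leq_exp2l // (_ : rho ^ 4 = N * N)%N; last by rewrite /N NE; ring.
rewrite -[X in (X * N)%N](card_ord N) -sum_nat_const leq_sum // => i _.
by rewrite (leq_trans (leq_subr _ _)) // ltnW.
Qed.

(** * Congruences between orbit points *)

Lemma coprimez_prime_ndvd (p : nat) (x y : int) : prime p ->
  coprimez x y -> (p %| x)%Z -> ~~ (p %| y)%Z.
Proof.
rewrite coprimezE !dvdzE /= => p_pr cop px; apply/negP => py.
have := dvdn_gcd p `|x| `|y|; rewrite px py (eqP cop) dvdn1 => /eqP p1.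
by move: p_pr; rewrite p1.
Qed.

Lemma Euclid_dvdz (p : nat) (x y : int) : prime p ->
  (p %| x * y)%Z = (p %| x)%Z || (p %| y)%Z.
Proof. by move=> p_pr; rewrite !dvdzE abszM Euclid_dvdM. Qed.

Lemma Euclid_dvdzX (p : nat) (x : int) (n : nat) : prime p ->
  (p %| x ^+ n)%Z = (p %| x)%Z && (0 < n)%N.
Proof. by move=> p_pr; rewrite !dvdzE abszX Euclid_dvdX. Qed.

Lemma Gauss_primepow (p k : nat) (x y : int) : prime p -> ~~ (p %| x)%Z ->
  (p%:Z ^+ k %| x * y)%Z = (p%:Z ^+ k %| y)%Z.
Proof.
move=> p_pr p_x; rewrite Gauss_dvdzr // coprimezXl // coprimezE.
by rewrite prime_coprime.
Qed.

(** First-order Taylor expansion of [y ^ i] at [x], multiplied by [x] so that no exponent [i - 1]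
    occurs. *)
Lemma sub_powers_mod_sq (p x y : int) (i : nat) : (p %| y - x)%Z ->
  (p ^+ 2 %| y ^+ i * x - x ^+ i.+1 - x ^+ i * (y - x) * i%:R)%Z.
Proof.
move=> p_yx; elim: i => [|i IHi]; first by rewrite mulr0 expr0 expr1 mul1r subrr subr0.
have -> : y ^+ i.+1 * x - x ^+ i.+2 - x ^+ i.+1 * (y - x) * i.+1%:R =
    y * (y ^+ i * x - x ^+ i.+1 - x ^+ i * (y - x) * i%:R) +
    x ^+ i * i%:R * (y - x) ^+ 2 by rewrite !exprS -natr1; ring.
by apply: rpredD; rewrite dvdz_mull // dvdz_exp2r.
Qed.

(** Modulo [p ^ 2], [x] times the sum is [p x ^ p] plus a multiple of [(y - x) C(p, 2)]. For odd [p]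
    the latter vanishes, as [p] divides both factors. *)
Lemma geometric_sum_prime (p : nat) (x y : int) : prime p -> odd p ->
  (p %| x - y)%Z -> ~~ (p %| x)%Z ->
  exists2 t : int, \sum_(i < p) x ^+ (p.-1 - i) * y ^+ i = p%:Z * t &
    ~~ (p %| t)%Z.
Proof.
move=> p_pr p_odd p_xy p_x; set S := \sum_(i < p) _.
have p_yx : (p %| y - x)%Z by rewrite -opprB rpredN.
have p_gt0 := prime_gt0 p_pr.
have p_gt2 := odd_prime_gt2 p_odd p_pr.
have p2S : (p%:Z ^+ 2 %| x * S - p%:Z * x ^+ p)%Z.
  have -> : x * S - p%:Z * x ^+ p = x ^+ p.-1 * (y - x) * 'C(p, 2)%:R +
      \sum_(i < p) x ^+ (p.-1 - i) *
        (y ^+ i * x - x ^+ i.+1 - x ^+ i * (y - x) * i%:R).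
    rewrite -bin2_sum big_mkord natr_sum !mulr_sumr -big_split /=.
    have -> : p%:Z * x ^+ p = \sum_(i < p) x ^+ p.
      by rewrite sumr_const card_ord -mulr_natl natz.
    rewrite -sumrB; apply: eq_bigr => i _.
    have le_i : (i <= p.-1)%N by rewrite -ltnS prednK.
    have eq1 : x ^+ p.-1 = x ^+ (p.-1 - i) * x ^+ i by rewrite -exprD subnK.
    have -> : x ^+ p = x * (x ^+ (p.-1 - i) * x ^+ i).
      by rewrite -eq1 -exprS prednK.
    by rewrite eq1 exprS; ring.
  apply: rpredD; last by apply: rpred_sum => i _; rewrite dvdz_mull ?sub_powers_mod_sq.
  rewrite -mulrA dvdz_mull // expr2 dvdz_mul //.
  by rewrite natz dvdzE /= prime_dvd_bin.
have pS : (p %| S)%Z.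
  have : (p %| x * S - p%:Z * x ^+ p)%Z.
    by apply: dvdz_trans p2S; rewrite expr2 dvdz_mulr.
  rewrite rpredBr; last by rewrite dvdz_mulr.
  rewrite Euclid_dvdz //.
  by rewrite (negbTE p_x).
have /dvdzP[t St] := pS; exists t; first by rewrite St mulrC.
apply: contra p_x => pt; rewrite St in p2S.
have : (p%:Z * p%:Z %| p%:Z * x ^+ p)%Z.
  have pxS : (p%:Z ^+ 2 %| x * (t * p%:Z))%Z by rewrite dvdz_mull // dvdz_mul.
  by rewrite -expr2; move: p2S; rewrite rpredBl.
rewrite dvdz_mul2l ?eqz_nat -?lt0n // Euclid_dvdzX // => /andP[//].
Qed.

(** Induction stripping factors [p] from [u]. Each costs exactly one [p] by [geometric_sum_prime];
    once [p] is prime to [u], the remaining geometric sum is [u x ^ (u - 1)] modulo [p], a unit. The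
    parity hypothesis excludes [p = 2] while stripping. *)
Lemma lifting_the_exponent (p : nat) (x y : int) (u m : nat) :
  prime p -> odd p || odd u -> (0 < u)%N ->
  (p %| x - y)%Z -> ~~ (p %| x)%Z ->
  (p%:Z ^+ m %| x ^+ u - y ^+ u)%Z -> (p%:Z ^+ m %| (x - y) *+ u)%Z.
Proof.
move=> p_pr; elim/ltn_ind: u m => u IHu m odd_pu u_gt0 p_xy p_x pm.
have [/dvdnP[v def_u]|p_u] := boolP (p %| u)%N; last first.
  rewrite -mulr_natl dvdz_mull //; move: pm; rewrite subrXX mulrC.
  rewrite Gauss_primepow //.
  have pS : (p %| \sum_(i < u) x ^+ (u.-1 - i) * y ^+ i - u%:Z * x ^+ u.-1)%Z.
    have -> : u%:Z * x ^+ u.-1 = \sum_(i < u) x ^+ u.-1.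
      by rewrite sumr_const card_ord -mulr_natl natz.
    rewrite -sumrB; apply: rpred_sum => i _.
    have le_i : (i <= u.-1)%N by rewrite -ltnS prednK.
    have -> : x ^+ u.-1 = x ^+ (u.-1 - i) * x ^+ i by rewrite -exprD subnK.
    rewrite -mulrBr dvdz_mull //.
    by rewrite -opprB rpredN subrXX dvdz_mulr.
  apply/negP => pS'; move: pS; rewrite rpredBl // Euclid_dvdz //.
  by rewrite Euclid_dvdzX // (negbTE p_x) orbF dvdzE /= (negbTE p_u).
have p_odd : odd p.
  case/orP: odd_pu => // odd_u; case: (even_prime p_pr) => // p2.
  by move: odd_u; rewrite def_u oddM p2 andbF.
case: m pm => [|m] pm; first by rewrite expr0 dvd1z.
have v_gt0 : (0 < v)%N by move: u_gt0; rewrite def_u muln_gt0 => /andP[].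
have p_xyv : (p %| x ^+ v - y ^+ v)%Z by rewrite subrXX dvdz_mulr.
have p_xv : ~~ (p %| x ^+ v)%Z by rewrite Euclid_dvdzX // (negbTE p_x).
have [t St p_t] := geometric_sum_prime p_pr p_odd p_xyv p_xv.
move: pm; rewrite def_u !exprM [X in (_ %| X)%Z]subrXX St mulrCA exprS.
rewrite dvdz_mul2l ?eqz_nat -?lt0n ?prime_gt0 // mulrC Gauss_primepow // => pm.
have lt_vu : (v < u)%N by rewrite def_u ltn_Pmulr ?prime_gt1.
have := IHu v lt_vu m _ v_gt0 p_xy p_x pm; rewrite p_odd => /(_ isT) h.
by rewrite mulrnA -mulr_natl dvdz_mul // natz.
Qed.

(** Both powers of [a / b] approximate [c / d], so their quotient is close to 1. If [p] divides [a]
    or [b], then [a ^ w - b ^ w] is prime to [p], and the full power of [p] falls on [a ^ e1] or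
    [b ^ e1]. *)
Lemma eliminate_target (p k : nat) (a b c d : int) (e1 e2 : nat) :
  prime p -> (0 < k)%N -> coprimez a b -> coprimez c d -> (0 < e1 < e2)%N ->
  (p%:Z ^+ k %| a ^+ e1 * d - c * b ^+ e1)%Z ->
  (p%:Z ^+ k %| a ^+ e2 * d - c * b ^+ e2)%Z ->
  [\/ (p%:Z ^+ k %| a ^+ (e2 - e1) - b ^+ (e2 - e1))%Z,
      (p%:Z ^+ k %| a ^+ e1)%Z | (p%:Z ^+ k %| b ^+ e1)%Z].
Proof.
move=> p_pr k_gt0 cop_ab cop_cd /andP[e1_gt0 lt_e] pk1 pk2.
set w := (e2 - e1)%N; have w_gt0 : (0 < w)%N by rewrite subn_gt0.
have e2E : e2 = (w + e1)%N by rewrite subnK // ltnW.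
have not_both := coprimez_prime_ndvd p_pr.
have p1 : (p %| a ^+ e1 * d - c * b ^+ e1)%Z.
  by apply: dvdz_trans pk1; apply: dvdz_exp.
have kill_b : (p%:Z ^+ k %| c * (b ^+ e1 * (a ^+ w - b ^+ w)))%Z.
  have -> : c * (b ^+ e1 * (a ^+ w - b ^+ w)) =
      (a ^+ e2 * d - c * b ^+ e2) - a ^+ w * (a ^+ e1 * d - c * b ^+ e1).
    by rewrite e2E !exprD; ring.
  by apply: rpredB => //; rewrite dvdz_mull.
have kill_a : (p%:Z ^+ k %| d * ((a ^+ w - b ^+ w) * a ^+ e1))%Z.
  have -> : d * ((a ^+ w - b ^+ w) * a ^+ e1) =
      (a ^+ e2 * d - c * b ^+ e2) - b ^+ w * (a ^+ e1 * d - c * b ^+ e1).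
    by rewrite e2E !exprD; ring.
  by apply: rpredB => //; rewrite dvdz_mull.
have [p_b|p_b] := boolP (p %| b)%Z.
  have p_a : ~~ (p %| a)%Z by apply: contraL p_b; apply: not_both.
  have p_d : (p %| d)%Z.
    move: p1; rewrite rpredBr; last by rewrite dvdz_mull // Euclid_dvdzX ?p_b.
    by rewrite Euclid_dvdz // Euclid_dvdzX // (negbTE p_a).
  have p_c : ~~ (p %| c)%Z by apply: contraL p_d; apply: not_both.
  constructor 3; move: kill_b; rewrite Gauss_primepow // mulrC Gauss_primepow //.
  by rewrite rpredBr Euclid_dvdzX // ?(negbTE p_a) // p_b.
have [p_c|p_c] := boolP (p %| c)%Z; last first.
  constructor 1; move: kill_b; rewrite Gauss_primepow // Gauss_primepow //.
  by rewrite Euclid_dvdzX // (negbTE p_b).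
have p_d := not_both _ _ cop_cd p_c.
have p_a : (p %| a)%Z.
  move: p1; rewrite rpredBr; last by rewrite dvdz_mulr.
  by rewrite Euclid_dvdz // (negbTE p_d) orbF Euclid_dvdzX // => /andP[].
constructor 2; move: kill_a; rewrite Gauss_primepow // Gauss_primepow //.
by rewrite rpredBl Euclid_dvdzX // ?(negbTE p_b) // p_a.
Qed.

(** Raising the first congruence to the power [w + 2] and comparing with the second gives
    [beta ^ (w + 2) = beta] for [beta = c / d], hence [beta ^ (w + 1) = 1] when [p] is prime to the
    coordinates. *)
Lemma eliminate_orbit (p k : nat) (a b c d : int) (e w : nat) :
  prime p -> (0 < k)%N -> coprimez a b -> coprimez c d -> (0 < e)%N ->
  (p%:Z ^+ k %| a ^+ e * d - c * b ^+ e)%Z ->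
  (p%:Z ^+ k %| a ^+ (e * w.+2) * d - c * b ^+ (e * w.+2))%Z ->
  [\/ (p%:Z ^+ k %| c)%Z, (p%:Z ^+ k %| d)%Z |
    [/\ ~~ (p %| a)%Z, ~~ (p %| b)%Z, ~~ (p %| c)%Z &
      (p%:Z ^+ k %| c ^+ w.+1 - d ^+ w.+1)%Z]].
Proof.
move=> p_pr k_gt0 cop_ab cop_cd e_gt0 pk1 pk2.
have not_both := coprimez_prime_ndvd p_pr.
have p1 : (p %| a ^+ e * d - c * b ^+ e)%Z.
  by apply: dvdz_trans pk1; apply: dvdz_exp.
have pkw : (p%:Z ^+ k %| (a ^+ e * d) ^+ w.+2 - (c * b ^+ e) ^+ w.+2)%Z.
  by rewrite subrXX dvdz_mulr.
have kill_b : (p%:Z ^+ k %| b ^+ (e * w.+2) * ((c ^+ w.+1 - d ^+ w.+1) * c))%Z.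
  have -> : b ^+ (e * w.+2) * ((c ^+ w.+1 - d ^+ w.+1) * c) =
      (a ^+ (e * w.+2) * d - c * b ^+ (e * w.+2)) * d ^+ w.+1 -
      ((a ^+ e * d) ^+ w.+2 - (c * b ^+ e) ^+ w.+2).
    by rewrite !exprMn -!exprM !(exprS _ w.+1); ring.
  by apply: rpredB => //; rewrite dvdz_mulr.
have kill_a : (p%:Z ^+ k %| a ^+ (e * w.+2) * ((c ^+ w.+1 - d ^+ w.+1) * d))%Z.
  have -> : a ^+ (e * w.+2) * ((c ^+ w.+1 - d ^+ w.+1) * d) =
      (a ^+ (e * w.+2) * d - c * b ^+ (e * w.+2)) * c ^+ w.+1 -
      ((a ^+ e * d) ^+ w.+2 - (c * b ^+ e) ^+ w.+2).
    by rewrite !exprMn -!exprM !(exprS _ w.+1); ring.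
  by apply: rpredB => //; rewrite dvdz_mulr.
have [p_b|p_b] := boolP (p %| b)%Z.
  have p_a : ~~ (p %| a)%Z by apply: contraL p_b; apply: not_both.
  have p_d : (p %| d)%Z.
    move: p1; rewrite rpredBr; last by rewrite dvdz_mull // Euclid_dvdzX ?p_b.
    by rewrite Euclid_dvdz // Euclid_dvdzX // (negbTE p_a).
  have p_c : ~~ (p %| c)%Z by apply: contraL p_d; apply: not_both.
  constructor 2; move: kill_a; rewrite Gauss_primepow ?Gauss_primepow //.
    by rewrite rpredBr Euclid_dvdzX // ?(negbTE p_c) // p_d.
  by rewrite Euclid_dvdzX // (negbTE p_a).
have [p_a|p_a] := boolP (p %| a)%Z.
  have p_c : (p %| c)%Z.
    move: p1; rewrite rpredBl; last by rewrite dvdz_mulr // Euclid_dvdzX ?p_a.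
    by rewrite Euclid_dvdz // Euclid_dvdzX // (negbTE p_b) orbF.
  have p_d := not_both _ _ cop_cd p_c.
  constructor 1; move: kill_b; rewrite Gauss_primepow ?Gauss_primepow //.
    by rewrite rpredBl Euclid_dvdzX // ?(negbTE p_d) // p_c.
  by rewrite Euclid_dvdzX // (negbTE p_b).
have p_c : ~~ (p %| c)%Z.
  apply/negP => p_c; have := not_both _ _ cop_cd p_c; apply/negP/negPn.
  move: p1; rewrite rpredBr; last by rewrite dvdz_mulr.
  by rewrite Euclid_dvdz // Euclid_dvdzX // (negbTE p_a).
constructor 3; split => //; move: kill_b.
rewrite Gauss_primepow ?Euclid_dvdzX ?(negbTE p_b) // mulrC.
by rewrite Gauss_primepow.
Qed.

(** * Archimedean estimates *)

(** With [u = y / x < 1], the assumptions give [c u < d + 1/5] and [c u ^ 2 > d - 1/5]. Eliminating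
    [u] yields [(d + 1/5) ^ 2 > c (d - 1/5)], impossible for [c >= d + 1]. *)
Lemma arch_growth_pos (x y c d : int) (w : nat) :
  0 < y < x -> 0 < d < c ->
  5 * `|x * d - c * y| < x -> 5 * `|x ^+ w.+2 * d - c * y ^+ w.+2| < x ^+ w.+2 ->
  False.
Proof.
move=> /andP[y0 lt_yx] /andP[d0 lt_dc] bad1 bad2.
have x0 : 0 < x by apply: lt_trans lt_yx.
have X0 : 0 < x ^+ w.+2 by rewrite exprn_gt0.
have leXY : y ^+ w.+2 * x ^+ 2 <= x ^+ w.+2 * y ^+ 2.
  have -> : y ^+ w.+2 * x ^+ 2 = y ^+ w * (x ^+ 2 * y ^+ 2).
    by rewrite -addn2 exprD; ring.
  have -> : x ^+ w.+2 * y ^+ 2 = x ^+ w * (x ^+ 2 * y ^+ 2).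
    by rewrite -addn2 exprD; ring.
  rewrite ler_wpM2r ?mulr_ge0 ?exprn_ge0 ?(ltW x0) ?(ltW y0) //.
  by rewrite lerXn2r ?nnegrE ?ltW.
have h1 : 5 * (c * y) < (5 * d + 1) * x by lia.
have h2 : (5 * d - 1) * x ^+ w.+2 < 5 * (c * y ^+ w.+2) by lia.
set X := x ^+ w.+2 in X0 leXY h2; set Y := y ^+ w.+2 in leXY h2.
have h3 : (5 * d - 1) * x ^+ 2 * X < 5 * c * y ^+ 2 * X.
  apply: (@lt_le_trans _ _ (5 * (c * Y) * x ^+ 2)).
    by rewrite mulrAC ltr_pM2r ?exprn_gt0.
  have -> : 5 * (c * Y) * x ^+ 2 = 5 * c * (Y * x ^+ 2) by ring.
  have -> : 5 * c * y ^+ 2 * X = 5 * c * (X * y ^+ 2) by ring.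
  by rewrite ler_wpM2l // mulr_ge0 // ltW // (lt_trans d0).
rewrite ltr_pM2r // in h3.
have c0 : 0 < c by apply: lt_trans lt_dc.
have h4 : (5 * d - 1) * (5 * c) * x ^+ 2 < (5 * d + 1) ^+ 2 * x ^+ 2.
  apply: (@lt_trans _ _ ((5 * (c * y)) ^+ 2)).
    have -> : (5 * (c * y)) ^+ 2 = 5 * c * y ^+ 2 * (5 * c) by ring.
    by rewrite mulrAC ltr_pM2r // mulr_gt0.
  have ge0 : 0 <= 5 * (c * y) by rewrite !mulr_ge0 // ltW.
  by rewrite -exprMn ltrXn2r.
rewrite ltr_pM2r ?exprn_gt0 // in h4.
have : (5 * d - 1) * (5 * (d + 1)) <= (5 * d - 1) * (5 * c).
  by rewrite ler_wpM2l; lia.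
by move: h4; rewrite expr2; lia.
Qed.

(** Put [v = d / c]. From [x v > y - 1/5] and [x >= y + 1] follows
    [x ^ (w + 2) v > (y - 1/5) (y + 1) y ^ w], which is already too large to be within 1/5 of
    [y ^ (w + 2)]. *)
Lemma arch_target_pos (x y c d : int) (w : nat) :
  0 < y < x -> 0 < d < c ->
  5 * `|x * d - c * y| < c -> 5 * `|x ^+ w.+2 * d - c * y ^+ w.+2| < c ->
  False.
Proof.
move=> /andP[y0 lt_yx] /andP[d0 lt_dc] bad1 bad2.
have x0 : 0 < x by apply: lt_trans lt_yx.
have c0 : 0 < c by apply: lt_trans lt_dc.
have h1 : (5 * y - 1) * c < 5 * (x * d) by lia.
have h2 : 5 * (x ^+ w.+2 * d) < (5 * y ^+ w.+2 + 1) * c by lia.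
set P := y ^+ w; have P0 : 1 <= P by rewrite -gtz0_ge1 exprn_gt0.
have leP : (y + 1) * P <= x ^+ w.+1.
  rewrite exprS ler_pM //; try lia.
  by rewrite lerXn2r ?nnegrE ?ltW.
have h3 : (5 * y - 1) * c * ((y + 1) * P) < (5 * y ^+ w.+2 + 1) * c.
  apply: le_lt_trans h2; rewrite [x ^+ _]exprS.
  have -> : 5 * (x * x ^+ w.+1 * d) = 5 * (x * d) * x ^+ w.+1 by ring.
  apply: ler_pM => //; last exact: ltW.
    by apply: mulr_ge0; lia.
  by apply: mulr_ge0; lia.
have : (5 * y - 1) * ((y + 1) * P) * c < (5 * y ^+ w.+2 + 1) * c.
  by rewrite mulrAC.
have -> : y ^+ w.+2 = y * y * P by rewrite !exprS mulrA.
rewrite ltr_pM2r // => h4.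
have y_P : 0 <= (y - 1) * P by apply: mulr_ge0; lia.
have : (5 * y - 1) * ((y + 1) * P) = 5 * (y * y * P) + 4 * ((y - 1) * P) + 3 * P.
  by ring.
move: h4 y_P P0; set u := (_ * _ * P); set t := ((y - 1) * P); lia.
Qed.

Lemma approx_swap (x y c d : int) : `|x * d - c * y| = `|y * c - d * x|.
Proof. by rewrite -normrN opprB ![_ * y]mulrC [x * d]mulrC. Qed.

(** No cancellation can occur when [c] and [d] have opposite signs or when [|c| < |d|], for then
    [c / d] does not lie on the same side of 1 as [x / y] among the positive numbers. *)
Lemma arch_cases (x y c d : int) : 0 < y < x -> c != 0 -> d != 0 ->
  [\/ 0 < d < c, 0 < - d < - c |
      x <= `|x * d - c * y| /\ (`|c| <= `|x * d - c * y| /\ `|d| <= `|x * d - c * y|)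
      \/ `|c| = `|d|].
Proof.
move=> /andP[y0 lt_yx] c0 d0.
have [?|?|?] := ltgtP `|c| `|d|; last by constructor 3; right.
  constructor 3; left; split; [|split]; nia.
have [/andP[??]|h] := boolP ((0 < c) && (0 < d)); first by constructor 1; lia.
have [/andP[??]|h'] := boolP ((c < 0) && (d < 0)); first by constructor 2; lia.
constructor 3; left; split; [|split]; nia.
Qed.

Lemma arch_growth (x y c d : int) (w : nat) :
  0 < x -> 0 < y -> x != y -> c != 0 -> d != 0 -> `|c| != `|d| ->
  5 * `|x * d - c * y| < Num.max x y ->
  5 * `|x ^+ w.+2 * d - c * y ^+ w.+2| < Num.max (x ^+ w.+2) (y ^+ w.+2) ->
  False.
Proof.
wlog lt_yx : x y c d / y < x => [hw x0 y0 neq_xy c0 d0 neq_cd|].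
  have /orP[lt_xy|lt_yx] : (x < y) || (y < x) by rewrite -neq_lt.
    rewrite approx_swap (approx_swap (x ^+ _)) maxC [Num.max (x ^+ _) _]maxC.
    by apply: (hw y x d c); rewrite // eq_sym.
  exact: (hw x y c d).
move=> x0 y0 _ c0 d0 neq_cd; rewrite !max_l ?lerXn2r ?nnegrE ?ltW // => bad1 bad2.
have yx : 0 < y < x by rewrite y0.
have [dc|dc|[[le_x _]|]] := arch_cases yx c0 d0.
- exact: arch_growth_pos yx dc bad1 bad2.
- apply: (arch_growth_pos yx dc (w := w)).
    by rewrite mulrN mulNr -opprD normrN.
  by rewrite mulrN mulNr -opprD normrN.
- by move: bad1; lia.
by move=> eq_cd; rewrite eq_cd eqxx in neq_cd.
Qed.

Lemma arch_target (x y c d : int) (w : nat) :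
  0 < x -> 0 < y -> x != y -> c != 0 -> d != 0 -> `|c| != `|d| ->
  5 * `|x * d - c * y| < Num.max `|c| `|d| ->
  5 * `|x ^+ w.+2 * d - c * y ^+ w.+2| < Num.max `|c| `|d| ->
  False.
Proof.
wlog lt_yx : x y c d / y < x => [hw x0 y0 neq_xy c0 d0 neq_cd|].
  have /orP[lt_xy|lt_yx] : (x < y) || (y < x) by rewrite -neq_lt.
    rewrite approx_swap (approx_swap (x ^+ _)) maxC.
    by apply: (hw y x d c); rewrite // eq_sym.
  exact: (hw x y c d).
move=> x0 y0 _ c0 d0 neq_cd bad1 bad2.
have yx : 0 < y < x by rewrite y0.
have [dc|dc|[[_ [le_c le_d]]|]] := arch_cases yx c0 d0.
- apply: (arch_target_pos yx dc (w := w)); move: bad1 bad2; rewrite max_l; lia.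
- apply: (arch_target_pos yx dc (w := w)).
    rewrite mulrN mulNr -opprD normrN; move: bad1; rewrite max_l; lia.
  rewrite mulrN mulNr -opprD normrN; move: bad2; rewrite max_l; lia.
- by move: bad1; rewrite /Num.max; case: ifP; lia.
by move=> eq_cd; rewrite eq_cd eqxx in neq_cd.
Qed.

(** * Counting *)

(** With [k] the integer part of the base 2 logarithm of [n], the left side is at most
    [2 ^ (66 + 17 k)], and [66 + 17 k <= 2 ^ k] from [k = 8] on. *)
Lemma exp2_dominates (n : nat) : (256 <= n)%N ->
  (2 * n * (1024 * n * (4 * n ^ 3)) ^ 4 <= 2 ^ n)%N.
Proof.
move=> n_ge; have n_gt0 : (0 < n)%N by apply: leq_trans n_ge.
have [//|le_kn lt_nk] := andP (trunc_log_bounds (p := 2) _ n_gt0).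
set k := trunc_log 2 n in le_kn lt_nk.
have k_ge : (8 <= k)%N by apply: trunc_log_max.
have lin_k : (66 + 17 * k <= 2 ^ k)%N.
  rewrite -(subnK k_ge); elim: (k - 8)%N => [//|j IHj].
  by rewrite [in leqRHS]addSn expnS; move: IHj; set t := (2 ^ (j + 8))%N; lia.
have -> : (1024 * n * (4 * n ^ 3) = 2 ^ 12 * n ^ 4)%N.
  by rewrite mulnACA -expnS.
have le_n : (n <= 2 ^ k.+1)%N by apply: ltnW.
apply: (@leq_trans (2 ^ (1 + k.+1) * (2 ^ (12 + k.+1 * 4)) ^ 4)).
  apply: leq_mul; first by rewrite expnD leq_mul.
  by rewrite leq_exp2r // [leqRHS]expnD leq_mul // expnM leq_exp2r.
rewrite -expnM -expnD leq_exp2l //.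
apply: leq_trans le_kn; apply: leq_trans lin_k; clear; lia.
Qed.

(** * Several indices dominated by the same prime *)

Lemma dvdz_norm_le (m x : int) : x != 0 -> (m %| x)%Z -> (`|m| <= `|x|)%N.
Proof. by move=> x0; rewrite dvdzE; apply: dvdn_leq; rewrite absz_gt0. Qed.

Lemma pow_sub_neq0 (x y : int) (n : nat) : (0 < n)%N -> `|x| != `|y| ->
  x ^+ n - y ^+ n != 0.
Proof.
move=> n0; rewrite subr_eq0; apply: contra => /eqP/(congr1 Num.norm).
rewrite !normrX => /eqP; rewrite eqrXn2 ?normr_ge0 //.
Qed.

Lemma absz_pow_sub_le (x y : int) (B n : nat) :
  (`|x| <= B)%N -> (`|y| <= B)%N -> (2 <= B)%N ->
  (`|x ^+ n - y ^+ n| <= B ^ n.+1)%N.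
Proof.
move=> lex ley B2; apply: (@leq_trans (`|x ^+ n| + `|y ^+ n|)).
  by rewrite (leq_trans (leqD_dist _ 0 _)) // subr0 sub0r abszN.
apply: (@leq_trans (B ^ n + B ^ n)).
  by case: n => [|n]; rewrite ?expr0 // leq_add // abszX leq_exp2r.
by rewrite addnn -mul2n expnS leq_mul2r B2 orbT.
Qed.

Lemma absz_exp_le (x : int) (B n : nat) : (`|x| <= B)%N -> (`|x ^+ n| <= B ^ n)%N.
Proof. by case: n => [|n] lex; rewrite ?expr0 // abszX leq_exp2r. Qed.

Lemma prime_power_dvd_weaken (p k : nat) (x : int) : (0 < k)%N ->
  (p%:Z ^+ k %| x)%Z -> (p %| x)%Z.
Proof. by move=> k0; apply: dvdz_trans; apply: dvdz_exp. Qed.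

Lemma large_triple (a b c d : int) (p q C H G n1 n2 n3 k1 k2 k3 : nat) :
  prime p -> coprimez a b -> coprimez c d ->
  a != 0 -> b != 0 -> c != 0 -> d != 0 -> `|a| != `|b| -> `|c| != `|d| ->
  (`|a| <= H)%N -> (`|b| <= H)%N -> (`|c| <= G)%N -> (`|d| <= G)%N ->
  (2 <= H)%N -> (2 <= G)%N -> (0 < q)%N -> (1024 <= C)%N ->
  (n1 < n2 < n3)%N ->
  (p%:Z ^+ k1 %| a ^+ (2 ^ n1) * d - c * b ^+ (2 ^ n1))%Z ->
  (p%:Z ^+ k2 %| a ^+ (2 ^ n2) * d - c * b ^+ (2 ^ n2))%Z ->
  (p%:Z ^+ k3 %| a ^+ (2 ^ n3) * d - c * b ^+ (2 ^ n3))%Z ->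
  (H ^ (2 ^ n1) <= p ^ (k1 * (2 * q)))%N ->
  (H ^ (2 ^ n2) <= p ^ (k2 * (2 * q)))%N ->
  (H ^ (2 ^ n3) <= p ^ (k3 * (2 * q)))%N ->
  (G ^ (C * q ^ 2) <= H ^ (2 ^ n1))%N -> False.
Proof.
move=> p_pr cop_ab cop_cd a0 b0 c0 d0 neq_ab neq_cd.
move=> leaH lebH lecG ledG H2 G2 q_gt0 C_ge /andP[lt12 lt23].
move=> pk1 pk2 pk3 Hk1 Hk2 Hk3 GH.
have H_gt0 : (0 < H)%N by apply: leq_trans H2.
have G_gt0 : (0 < G)%N by apply: leq_trans G2.
have Q_gt0 : (0 < 2 * q)%N by rewrite muln_gt0.
have Hmono i j : (i <= j)%N -> (H ^ (2 ^ i) <= H ^ (2 ^ j))%N.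
  by move=> le_ij; rewrite leq_pexp2l // leq_exp2l.
have ltQC : (2 * q < C * q ^ 2)%N.
  have : (C * 1 <= C * q)%N by rewrite leq_mul2l q_gt0 orbT.
  by rewrite expnS expn1 mulnA ltn_pmul2r // => h; clear -h C_ge; lia.
have pow2_gt0 i : (0 < 2 ^ i)%N by rewrite expn_gt0.
have weak (k k' m : nat) : (k <= k')%N -> (p%:Z ^+ k' %|
    a ^+ (2 ^ m) * d - c * b ^+ (2 ^ m))%Z -> (p%:Z ^+ k %|
    a ^+ (2 ^ m) * d - c * b ^+ (2 ^ m))%Z by apply: dvdz_exp_sub.
have minP i k k' : (H ^ (2 ^ i) <= p ^ (k * (2 * q)))%N ->
    (H ^ (2 ^ i) <= p ^ (k' * (2 * q)))%N ->
    (H ^ (2 ^ i) <= p ^ (minn k k' * (2 * q)))%N.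
  by move=> h h'; rewrite /minn; case: ifP.
(* Elimination needs one common exponent for two consecutive indices; the minimum keeps the lower
   bound attached to the smaller index. *)
set m1 := minn k1 k2; set m2 := minn k2 k3.
have Hm1 : (H ^ (2 ^ n1) <= p ^ (m1 * (2 * q)))%N.
  by apply: minP => //; apply: leq_trans (Hmono _ _ (ltnW lt12)) Hk2.
have Hm2 : (H ^ (2 ^ n2) <= p ^ (m2 * (2 * q)))%N.
  by apply: minP => //; apply: leq_trans (Hmono _ _ (ltnW lt23)) Hk3.
have big k i : (H ^ (2 ^ i) <= p ^ (k * (2 * q)))%N -> (n1 <= i)%N -> (G < p ^ k)%N.
  move=> h le_i; rewrite ltnNge; apply/negP => le_pG.
  have := leq_trans GH (leq_trans (Hmono _ _ le_i) h).
  rewrite [leqRHS]expnM; apply/negP; rewrite -ltnNge.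
  apply: (@leq_ltn_trans (G ^ (2 * q))); first by rewrite leq_exp2r.
  by rewrite ltn_exp2l.
have pos k : (G < p ^ k)%N -> (0 < k)%N.
  by case: k => //; rewrite expn0 ltnNge G_gt0.
have Gm1 := big _ _ Hm1 (leqnn _); have Gm2 := big _ _ Hm2 (ltnW lt12).
have m1_gt0 := pos _ Gm1; have m2_gt0 := pos _ Gm2.
have two_gt i j : (i < j)%N -> exists w, (2 ^ (j - i))%N = w.+2.
  move=> lt_ij; have : (2 ^ 1 <= 2 ^ (j - i))%N by rewrite leq_exp2l // subn_gt0.
  by case: (2 ^ (j - i))%N => [|[|w]] // _; exists w.
have [w1 w1E] := two_gt _ _ lt12; have [w2 w2E] := two_gt _ _ lt23.
have e2E : (2 ^ n2 = 2 ^ n1 * w1.+2)%N by rewrite -w1E -expnD subnKC // ltnW.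
have e3E : (2 ^ n3 = 2 ^ n2 * w2.+2)%N by rewrite -w2E -expnD subnKC // ltnW.
have small (k : nat) (x : int) : (G < p ^ k)%N -> x != 0 -> (`|x| <= G)%N ->
    ~ (p%:Z ^+ k %| x)%Z.
  move=> ltG x0 lexG /(dvdz_norm_le x0); rewrite abszX absz_nat => le_px.
  by have := leq_trans ltG (leq_trans le_px lexG); rewrite ltnn.
have [p_a p_b p_c p_cd] : [/\ ~~ (p %| a)%Z, ~~ (p %| b)%Z, ~~ (p %| c)%Z &
    (p%:Z ^+ m1 %| c ^+ w1.+1 - d ^+ w1.+1)%Z].
  have := weak _ _ _ (geq_minl k1 k2) pk1; rewrite -/m1 => h1.
  have := weak _ _ _ (geq_minr k1 k2) pk2; rewrite -/m1 e2E => h2.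
  have [h|h|//] := eliminate_orbit p_pr m1_gt0 cop_ab cop_cd (pow2_gt0 n1) h1 h2.
    by case: (small _ _ Gm1 c0 lecG h).
  by case: (small _ _ Gm1 d0 ledG h).
have p_cd2 : (p%:Z ^+ m2 %| c ^+ w2.+1 - d ^+ w2.+1)%Z.
  have := weak _ _ _ (geq_minl k2 k3) pk2; rewrite -/m2 => h1.
  have := weak _ _ _ (geq_minr k2 k3) pk3; rewrite -/m2 e3E => h2.
  have [h|h|[]//] := eliminate_orbit p_pr m2_gt0 cop_ab cop_cd (pow2_gt0 n2) h1 h2.
    by case: (small _ _ Gm2 c0 lecG h).
  by case: (small _ _ Gm2 d0 ledG h).
(* [g] is a multiple of the order of [alpha] modulo [p]. Raising all data to the power [g] provides
   the congruence [a = b] that interpolation requires. *)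
set g := (2 ^ n2 - 2 ^ n1)%N.
have lt_2n12 : (2 ^ n1 < 2 ^ n2)%N by rewrite ltn_exp2l.
have p_ab : (p %| a ^+ g - b ^+ g)%Z.
  have := weak _ _ _ (geq_minl k1 k2) pk1; rewrite -/m1 => h1.
  have := weak _ _ _ (geq_minr k1 k2) pk2; rewrite -/m1 => h2.
  have lt_e : (0 < 2 ^ n1 < 2 ^ n2)%N by rewrite pow2_gt0.
  have [h|h|h] := eliminate_target p_pr m1_gt0 cop_ab cop_cd lt_e h1 h2.
  - exact: prime_power_dvd_weaken h.
  - have := prime_power_dvd_weaken m1_gt0 h.
    by rewrite Euclid_dvdzX // (negbTE p_a).
  have := prime_power_dvd_weaken m1_gt0 h.
  by rewrite Euclid_dvdzX // (negbTE p_b).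
(* The lifting lemma is applied to [c ^ (w1 + 1)] and [d ^ (w1 + 1)], already congruent modulo [p],
   with the odd exponent [w2 + 1 = 2 ^ (n3 - n2) - 1]. The power [p ^ m2] then divides their
   difference times [w2 + 1]. *)
have le_pm2 : (p ^ m2 <= G ^ w1.+2 * 2 ^ n3)%N.
  have odd_w2 : odd w2.+1.
    have : odd (2 ^ (n3 - n2)) = false by rewrite oddX /= orbF subn_eq0 leqNgt lt23.
    by rewrite w2E /= => /negbFE.
  have xy0 := pow_sub_neq0 (ltn0Sn w1) neq_cd.
  have p_xy := prime_power_dvd_weaken m1_gt0 p_cd.
  have p_x : ~~ (p %| c ^+ w1.+1)%Z by rewrite Euclid_dvdzX // (negbTE p_c).
  have := @lifting_the_exponent p (c ^+ w1.+1) (d ^+ w1.+1) w2.+1 m2 p_pr.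
  rewrite odd_w2 orbT => /(_ isT isT p_xy p_x); rewrite -!exprM.
  rewrite [(w1.+1 * _)%N]mulnC !exprM subrXX dvdz_mulr // => /(_ isT).
  move=> /dvdz_norm_le; rewrite mulrn_eq0 /= => /(_ xy0).
  rewrite abszX absz_nat => /leq_trans; apply.
  rewrite -mulr_natr abszM natz absz_nat leq_mul ?absz_pow_sub_le //.
  by apply: (@leq_trans w2.+2) => //; rewrite -w2E leq_exp2l // leq_subr.
(* After squaring the bound, the power of [G] is absorbed by one factor [H ^ (2 ^ n2)] thanks to
   [GH]. Cancelling that factor bounds every height in terms of [q] and [n3]. *)
have key : (H ^ (2 ^ n2) <= 2 ^ (4 * q * n3))%N.
  have step : (H ^ (2 ^ n2) <= (G ^ w1.+2 * 2 ^ n3) ^ (2 * q))%N.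
    by apply: leq_trans Hm2 _; rewrite expnM leq_exp2r.
  have GHw : (G ^ (2 * (2 * q) * w1.+2) <= H ^ (2 ^ n2))%N.
    rewrite e2E [leqLHS]expnM [leqRHS]expnM leq_exp2r //; apply: leq_trans GH.
    rewrite leq_pexp2l //; clear -q_gt0 C_ge; rewrite mulnA.
    have : (C * 1 <= C * q)%N by rewrite leq_mul2l q_gt0 orbT.
    rewrite expnS expn1 mulnA leq_mul2r => h.
    by apply/orP; right; lia.
  have sq : ((G ^ w1.+2 * 2 ^ n3) ^ (2 * q) * (G ^ w1.+2 * 2 ^ n3) ^ (2 * q) =
      G ^ (2 * (2 * q) * w1.+2) * 2 ^ (4 * q * n3))%N.
    by rewrite -expnD expnMn -!expnM; congr (_ ^ _ * _ ^ _)%N; ring.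
  have := leq_mul step step; rewrite sq.
  move=> h; have {}h := leq_trans h (leq_mul GHw (leqnn _)).
  by rewrite leq_pmul2l ?expn_gt0 ?H_gt0 in h.
set n := n3 in key pk3 Hk3 *.
have le_2n2 : (2 ^ n2 <= 4 * q * n)%N.
  rewrite -(leq_exp2l (m := 2)) //; apply: leq_trans key.
  by rewrite leq_exp2r // expn_gt0.
have G_key : (G ^ (C * q ^ 2) <= 2 ^ (4 * q * n))%N.
  by apply: leq_trans GH (leq_trans (Hmono _ _ (ltnW lt12)) key).
have le_Cq : (C * q <= 4 * n)%N.
  rewrite -(leq_pmul2r q_gt0) -mulnA mulnn [(4 * n * q)%N]mulnAC.
  rewrite -(leq_exp2l (m := 2)) //; apply: leq_trans G_key.
  by rewrite leq_exp2r // muln_gt0 expn_gt0 q_gt0 (leq_trans _ C_ge).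
have n_ge : (256 <= n)%N.
  have : (C * 1 <= C * q)%N by rewrite leq_mul2l q_gt0 orbT.
  by clear -C_ge le_Cq; lia.
have le_qn : (q <= n)%N.
  have : (1024 * q <= C * q)%N by rewrite leq_mul2r C_ge orbT.
  by clear -le_Cq; lia.
have le_G : (G <= 2 ^ n)%N.
  rewrite -(@leq_exp2r _ _ (4 * q)) ?muln_gt0 // -expnM [(n * _)%N]mulnC.
  apply: leq_trans G_key; rewrite leq_pexp2l //.
  rewrite expnS expn1 mulnA leq_mul2r; apply/orP; right.
  have : (C * 1 <= C * q)%N by rewrite leq_mul2l q_gt0 orbT.
  by clear -C_ge; lia.
have n_gt0 : (0 < n)%N by apply: leq_trans n_ge.
have g_gt0 : (0 < g)%N by rewrite subn_gt0.
have le_g : (g <= 4 * q * n)%N by apply: leq_trans (leq_subr _ _) le_2n2.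
(* [Y] bounds the bit sizes of the [g]-th powers: [4 q n] for [a] and [b], and [n (4 q n)] for [c]
   and [d], with [q <= n]. *)
set Y := (4 * n ^ 3)%N.
have Y_gt0 : (0 < Y)%N by rewrite muln_gt0 expn_gt0 n_gt0.
have le_qnY : (4 * q * n <= Y)%N.
  rewrite /Y -mulnA leq_mul2l /= expnS expnS expn1 leq_mul //.
  by rewrite leq_pmulr.
have bound_ab (x : int) : (`|x| <= H)%N -> `|x ^+ g| <= 2 ^+ Y.
  move=> lex; rewrite -abszE -natrX -natz ler_nat.
  apply: leq_trans (absz_exp_le _ lex) _.
  apply: (@leq_trans (H ^ (2 ^ n2))); first by rewrite leq_pexp2l // leq_subr.
  by apply: leq_trans key _; rewrite leq_exp2l.
have bound_cd (x : int) : (`|x| <= G)%N -> `|x ^+ g| <= 2 ^+ Y.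
  move=> lex; rewrite -abszE -natrX -natz ler_nat.
  apply: leq_trans (absz_exp_le _ lex) _.
  apply: (@leq_trans ((2 ^ n) ^ g)); first by rewrite leq_exp2r.
  rewrite -expnM leq_exp2l // /Y (@leq_trans (n * (4 * q * n))) //.
    by rewrite leq_mul2l le_g orbT.
  have -> : (n * (4 * q * n) = 4 * (q * n ^ 2))%N by ring.
  by rewrite leq_mul2l /= [(n ^ 3)%N]expnS leq_mul2r le_qn orbT.
have dom := exp2_dominates n_ge; rewrite -/Y in dom.
have le_rho : (1024 * n * Y <= 2 ^ n)%N.
  apply: leq_trans dom; apply: (@leq_trans ((1024 * n * Y) ^ 4)).
    by rewrite -[leqLHS]expn1 leq_pexp2l // muln_gt0 Y_gt0 muln_gt0 n_gt0.
  by rewrite leq_pmull // muln_gt0.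
have pT : (p%:Z ^+ k3 %| (a ^+ g) ^+ (2 ^ n) * d ^+ g -
    c ^+ g * (b ^+ g) ^+ (2 ^ n))%Z.
  have -> : (a ^+ g) ^+ (2 ^ n) * d ^+ g - c ^+ g * (b ^+ g) ^+ (2 ^ n) =
      (a ^+ (2 ^ n) * d) ^+ g - (c * b ^+ (2 ^ n)) ^+ g.
    by rewrite !exprMn -!exprM ![(_ * g)%N]mulnC.
  by rewrite subrXX dvdz_mulr.
have p_bg : ~~ (p %| b ^+ g)%Z by rewrite Euclid_dvdzX // (negbTE p_b).
have neq_abg : `|a ^+ g| != `|b ^+ g| by rewrite !normrX eqrXn2.
have := power_approx_bound p_pr p_ab p_bg _ _ _ _ neq_abg n_gt0 Y_gt0 le_rho
  (bound_ab _ leaH) (bound_ab _ lebH) (bound_cd _ lecG) (bound_cd _ ledG) pT.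
rewrite !expf_neq0 // => /(_ isT isT isT isT) lt_p.
(* The contradiction: [p ^ (2 q k3)] is at least [2 ^ (2 ^ n)], yet below
   [2 ^ (2 q (1024 n Y) ^ 4)], which [dom] keeps under the same value. *)
have : (2 ^ (2 ^ n) <= p ^ (k3 * (2 * q)))%N.
  by apply: leq_trans Hk3; rewrite leq_exp2r // expn_gt0.
rewrite leqNgt => /negP; apply; rewrite [ltnLHS]expnM.
apply: (@leq_trans ((2 ^ (1024 * n * Y) ^ 4) ^ (2 * q))); first by rewrite ltn_exp2r.
rewrite -expnM leq_exp2l //; apply: leq_trans dom.
by rewrite [leqLHS]mulnC leq_mul // leq_mul.
Qed.

(** The common power of [p] is at least [H ^ (2 ^ m)], too large to divide any outcome of
    [eliminate_target]. For the first outcome, with [w = 2 ^ m - 2 ^ n], the size bound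
    [H ^ (w + 1)] suffices because [n > 0] makes [2 ^ n >= 2]. *)
Lemma small_pair (a b c d : int) (p H n m k1 k2 : nat) :
  prime p -> coprimez a b -> coprimez c d -> a != 0 -> b != 0 ->
  `|a| != `|b| -> (`|a| <= H)%N -> (`|b| <= H)%N -> (2 <= H)%N ->
  (0 < n < m)%N ->
  (p%:Z ^+ k1 %| a ^+ (2 ^ n) * d - c * b ^+ (2 ^ n))%Z ->
  (p%:Z ^+ k2 %| a ^+ (2 ^ m) * d - c * b ^+ (2 ^ m))%Z ->
  (H ^ (2 ^ m) <= p ^ k1)%N -> (H ^ (2 ^ m) <= p ^ k2)%N -> False.
Proof.
move=> p_pr cop_ab cop_cd a0 b0 neq_ab leaH lebH H2 /andP[n0 lt_nm] pk1 pk2 Hk1 Hk2.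
set k := minn k1 k2.
have Hk : (H ^ (2 ^ m) <= p ^ k)%N by rewrite /k /minn; case: ifP.
have H_gt1 e : (0 < e)%N -> (1 < H ^ e)%N by move=> e0; rewrite -[1%N](exp1n e) ltn_exp2r.
have k_gt0 : (0 < k)%N.
  rewrite lt0n; apply/eqP => k0; move: Hk; rewrite k0 expn0 leqNgt.
  by rewrite H_gt1 // expn_gt0.
have lt_e : (2 ^ n < 2 ^ m)%N by rewrite ltn_exp2l.
have e_gt0 : (0 < 2 ^ n < 2 ^ m)%N by rewrite expn_gt0.
have two_le : (2 <= 2 ^ n)%N by rewrite -[leqLHS]expn1 leq_exp2l.
have no_large (x : int) (e : nat) : x != 0 -> (e < 2 ^ m)%N -> (`|x| <= H ^ e)%N ->
    ~ (p%:Z ^+ k %| x)%Z.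
  move=> x0 lt_em lexH /(dvdz_norm_le x0); rewrite abszX absz_nat => le_px.
  have := leq_trans Hk (leq_trans le_px lexH).
  by rewrite leq_exp2l // leqNgt lt_em.
have := eliminate_target p_pr k_gt0 cop_ab cop_cd e_gt0
  (dvdz_exp_sub (geq_minl k1 k2) pk1) (dvdz_exp_sub (geq_minr k1 k2) pk2).
case; [apply: (no_large _ (2 ^ m - 2 ^ n).+1%N)|apply: (no_large _ (2 ^ n)%N)|
  apply: (no_large _ (2 ^ n)%N)]; rewrite ?expf_neq0 ?absz_exp_le //.
- by apply: pow_sub_neq0 => //; rewrite subn_gt0.
- by clear -two_le lt_e; lia.
exact: absz_pow_sub_le.
Qed.

(** * Dominating primes and pigeonhole counts *)

(** Otherwise every [p ^ (q v_p(N))] is below [N], and multiplying over the fewer than [q] prime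
    factors gives [N ^ q <= N ^ (q - 1)]. *)
Lemma dominating_prime (N q : nat) (P : seq nat) :
  (1 < N)%N -> (forall p, prime p -> (p %| N)%N -> p \in P) -> (size P < q)%N ->
  exists p, [/\ p \in P, prime p & (N <= p ^ (logn p N * q))%N].
Proof.
move=> N_gt1 NP lt_Pq; have N_gt0 : (0 < N)%N by apply: ltnW.
have [/hasP[p]|] := boolP (has (fun p => N <= p ^ (logn p N * q))%N (primes N)).
  rewrite mem_primes => /and3P[p_pr _ p_N] le_N.
  by exists p; split=> //; apply: NP.
move=> /hasPn small; exfalso.
have le_size : (size (primes N) <= size P)%N.
  apply: uniq_leq_size (primes_uniq N) _ => p; rewrite mem_primes.
  by case/and3P => p_pr _; apply: NP.
have : (N ^ q <= N ^ size (primes N))%N.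
  rewrite [X in (X ^ q <= _)%N](prod_prime_decomp N_gt0) prime_decompE big_map /=.
  rewrite (big_morph (expn^~ q) (fun x y => expnMn x y q) (exp1n q)).
  have -> : (N ^ size (primes N) = \prod_(p <- primes N) N)%N.
    by rewrite big_const_seq count_predT iter_muln muln1.
  rewrite big_seq [leqRHS]big_seq.
  apply: leq_prod => p p_N; rewrite -expnM ltnW // ltnNge; exact: small.
by rewrite leq_exp2l // leqNgt (leq_ltn_trans le_size).
Qed.

Lemma size_fibres (Y P : seq nat) (g : nat -> nat) (m : nat) :
  (forall n, n \in Y -> g n \in P) ->
  (forall p, (size [seq n <- Y | g n == p] <= m)%N) -> (size Y <= m * size P)%N.
Proof.
elim: P Y => [|p P IHP] Y gP fibre.
  by case: Y gP {fibre} => // n Y /(_ n (mem_head _ _)).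
rewrite /= mulnS -(count_predC (fun n => g n == p)) leq_add -?size_filter //.
apply: IHP => [n|r].
  by rewrite mem_filter /= => /andP[gn /gP]; rewrite inE (negbTE gn).
apply: leq_trans (fibre r); rewrite -filter_predI !size_filter.
by apply: sub_count => n /andP[].
Qed.

Lemma sort_sizeP (Y : seq nat) : uniq Y ->
  [/\ sorted ltn (sort leq Y), size (sort leq Y) = size Y & sort leq Y =i Y].
Proof.
move=> uY; split; [|exact: size_sort|exact: mem_sort].
by rewrite ltn_sorted_uniq_leq sort_uniq uY sort_sorted //; apply: leq_total.
Qed.

Lemma size_le1 (Y : seq nat) : uniq Y ->
  (forall n m, n \in Y -> m \in Y -> (n < m)%N -> False) -> (size Y <= 1)%N.
Proof.
move=> /sort_sizeP[+ <- memY] noY; case: (sort leq Y) memY => [|n [|m s]] //= memY.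
case/andP => lt_nm _; case: (noY n m); rewrite -?memY ?inE ?eqxx ?orbT //.
Qed.

Lemma size_le2 (Y : seq nat) : uniq Y ->
  (forall n m r, n \in Y -> m \in Y -> r \in Y -> (n < m < r)%N -> False) ->
  (size Y <= 2)%N.
Proof.
move=> /sort_sizeP[+ <- memY] noY.
case: (sort leq Y) memY => [|n [|m [|r s]]] //= memY.
case/and3P => lt_nm lt_mr _; case: (noY n m r); rewrite -?memY ?inE ?eqxx ?orbT //.
by rewrite lt_nm.
Qed.

(** The witness [t] is the largest minus the smallest element: an increasing list of naturals has at
    most [t + 1] terms. *)
Lemma size_window (Y : seq nat) (B : nat) : uniq Y -> (0 < B)%N ->
  (forall n m, n \in Y -> m \in Y -> (2 ^ m <= B * 2 ^ n)%N) ->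
  exists2 t, (2 ^ t <= B)%N & (size Y <= t.+1)%N.
Proof.
move=> /sort_sizeP[+ <- memY] B0 win; case: (sort leq Y) memY => [|n s] memY.
  by exists 0%N.
move=> /= path_s; set m := last n s.
have mY : m \in Y by rewrite -memY mem_last.
have nY : n \in Y by rewrite -memY mem_head.
have le_size r s' : path ltn r s' -> (r + size s' <= last r s')%N.
  elim: s' r => [|x s' IHs] r /=; first by rewrite addn0.
  by case/andP => lt_rx /IHs; clear -lt_rx; lia.
exists (m - n)%N; last by have := le_size _ _ path_s; rewrite -/m; clear; lia.
have le_nm : (n <= m)%N by have := le_size _ _ path_s; rewrite -/m; clear; lia.
have := win _ _ nY mY; rewrite -{1}(subnK le_nm) expnD leq_pmul2r ?expn_gt0 //.
Qed.

(** The indices fall into six classes, possibly overlapping. Zero and the two archimedean exceptions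
    account for three, the small range for [size P], the large range for [2 size P], and the middle
    window for [t + 1]. *)
Lemma core_bound (a b c d : int) (P X : seq nat) :
  coprimez a b -> coprimez c d -> a != 0 -> b != 0 -> c != 0 -> d != 0 ->
  `|a| != `|b| -> `|c| != `|d| -> uniq X ->
  (forall n, n \in X -> a ^+ (2 ^ n) * d - c * b ^+ (2 ^ n) != 0) ->
  (forall n p, n \in X -> prime p ->
     (p %| a ^+ (2 ^ n) * d - c * b ^+ (2 ^ n))%Z -> p \in P) ->
  exists2 t, (2 ^ t <= 4096 * (size P).+1 ^ 3)%N &
    (size X <= 3 * size P + t + 4)%N.
Proof.
move=> cop_ab cop_cd a0 b0 c0 d0 neq_ab neq_cd uniqX NX0 NXP.
pose N n := a ^+ (2 ^ n) * d - c * b ^+ (2 ^ n).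
pose f n := `|N n|%N; set q := (size P).+1.
pose H := maxn `|a| `|b|; pose G := maxn `|c| `|d|.
pose C := 1024%N.
have leaH : (`|a| <= H)%N by apply: leq_maxl.
have lebH : (`|b| <= H)%N by apply: leq_maxr.
have lecG : (`|c| <= G)%N by apply: leq_maxl.
have ledG : (`|d| <= G)%N by apply: leq_maxr.
have max_ge2 (x y : int) : x != 0 -> y != 0 -> `|x| != `|y| ->
    (2 <= maxn `|x| `|y|)%N by clear; lia.
have H2 : (2 <= H)%N by apply: max_ge2.
have G2 : (2 <= G)%N by apply: max_ge2.
have H0 : (0 < H)%N by apply: leq_trans H2.
have H_gt1 e : (0 < e)%N -> (1 < H ^ e)%N.
  by move=> e0; rewrite -[X in (X < _)%N](exp1n e) ltn_exp2r.
have ltQC : (4 * q <= C * q ^ 2)%N by rewrite expnS expn1 mulnA leq_mul2r; clear; lia.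
(* A dominating prime of [N n]; the default 0 is excluded by [dpP] whenever [f n > 1]. *)
pose dp n := head 0%N [seq p <- P | prime p && (f n <= p ^ (logn p (f n) * q))%N].
have dpP n : n \in X -> (1 < f n)%N ->
    [/\ dp n \in P, prime (dp n) & (f n <= dp n ^ (logn (dp n) (f n) * q))%N].
  move=> nX f_gt1; have fP p : prime p -> (p %| f n)%N -> p \in P.
    by move=> p_pr p_f; apply: NXP nX p_pr _; rewrite dvdzE.
  have [p [pP p_pr le_f]] := dominating_prime f_gt1 fP (ltnSn (size P)).
  have : dp n \in [seq p <- P | prime p && (f n <= p ^ (logn p (f n) * q))%N].
    rewrite /dp; have : p \in [seq p <- P | prime p && (f n <= p ^ (logn p (f n) * q))%N].
      by rewrite mem_filter p_pr le_f.
    by case: [seq _ <- _ | _] => //= *; rewrite mem_head.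
  by rewrite mem_filter => /andP[/andP[]].
have dvdN n p : (p%:Z ^+ logn p (f n) %| N n)%Z.
  by rewrite dvdzE abszX absz_nat pfactor_dvdnn.
have normE (x : int) n : (0 < n)%N -> x ^+ (2 ^ n) = (`|x| ^ (2 ^ n))%N%:Z.
  move=> n0; rewrite -abszX gez0_abs // exprn_even_ge0 //.
  by rewrite oddX orbF eqn0Ngt n0.
have pow_gt0 (x : int) n : (0 < n)%N -> x != 0 -> 0 < x ^+ (2 ^ n).
  by move=> n0 x0; rewrite normE // ltz_nat expn_gt0 absz_gt0 x0.
have pow_neq n : a ^+ (2 ^ n) != b ^+ (2 ^ n).
  by rewrite -subr_eq0 pow_sub_neq0 // expn_gt0.
have two_w n m : (n < m)%N -> exists w, (2 ^ m = 2 ^ n * w.+2)%N.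
  move=> lt_nm; have : (2 ^ 1 <= 2 ^ (m - n))%N by rewrite leq_exp2l // subn_gt0.
  have -> : (2 ^ m = 2 ^ n * 2 ^ (m - n))%N by rewrite -expnD subnKC // ltnW.
  by case: (2 ^ (m - n))%N => [|[|w]] // _; exists w.
have fE n : 5 * `|N n| = (5 * f n)%N%:Z by rewrite PoszM abszE.
have le_max n : (0 < n)%N ->
    ((H ^ (2 ^ n))%N%:Z <= Num.max (a ^+ (2 ^ n)) (b ^+ (2 ^ n))).
  move=> n0; rewrite !normE // le_max !lez_nat !leq_exp2r ?expn_gt0 //.
  by rewrite /H geq_max leqnn /= geq_max leqnn andbT leq_total.
have archG n m : (0 < n < m)%N -> (5 * f n < H ^ (2 ^ n))%N ->
    (5 * f m < H ^ (2 ^ m))%N -> False.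
  move=> /andP[n0 lt_nm] bad_n bad_m; have m0 : (0 < m)%N by apply: ltn_trans lt_nm.
  have [w wE] := two_w _ _ lt_nm.
  have := @arch_growth (a ^+ (2 ^ n)) (b ^+ (2 ^ n)) c d w
    (pow_gt0 _ _ n0 a0) (pow_gt0 _ _ n0 b0) (pow_neq n) c0 d0 neq_cd.
  rewrite -!exprM -wE -/(N n) -/(N m) !fE; apply.
    by apply: lt_le_trans (le_max n n0); rewrite ltz_nat.
  by apply: lt_le_trans (le_max m m0); rewrite ltz_nat.
have archT n m : (0 < n < m)%N -> (5 * f n < G)%N -> (5 * f m < G)%N -> False.
  move=> /andP[n0 lt_nm] bad_n bad_m.
  have [w wE] := two_w _ _ lt_nm.
  have GE : Num.max `|c| `|d| = G%:Z.
    rewrite /G -!abszE; case: (leqP `|c| `|d|) => h.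
      by rewrite max_r ?lez_nat.
    by rewrite max_l ?lez_nat // ltnW.
  have := @arch_target (a ^+ (2 ^ n)) (b ^+ (2 ^ n)) c d w
    (pow_gt0 _ _ n0 a0) (pow_gt0 _ _ n0 b0) (pow_neq n) c0 d0 neq_cd.
  by rewrite -!exprM -wE -/(N n) -/(N m) !fE GE !ltz_nat; apply.
(* Index 0 is set apart because the even exponents [2 ^ n], [n > 0], make the powers of [a] and [b]
   positive. The factor 5 is the margin of the archimedean lemmas. *)
pose Zero n := (n == 0)%N.
pose BadT n := (0 < n)%N && (5 * f n < G)%N.
pose BadG n := (0 < n)%N && (5 * f n < H ^ (2 ^ n))%N.
pose Small n := [&& 0 < n, 5 * H ^ (q * 2 ^ n) <= G & G <= 5 * f n]%N.
pose Large n := [&& 0 < n, G ^ (C * q ^ 2) <= H ^ (2 ^ n) & H ^ (2 ^ n) <= 5 * f n]%N.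
pose Middle n := [&& 0 < n, G < 5 * H ^ (q * 2 ^ n) & H ^ (2 ^ n) < G ^ (C * q ^ 2)]%N.
have cover : (size X <= count Zero X + count BadT X + count BadG X +
    count Small X + count Large X + count Middle X)%N.
  elim: (X) => //= n Y IHY; apply: (@leq_trans (1 + (count Zero Y + count BadT Y + count BadG Y +
    count Small Y + count Large Y + count Middle Y))); first by rewrite add1n ltnS.
  have : (1 <= Zero n + BadT n + BadG n + Small n + Large n + Middle n)%N.
    rewrite /Zero /BadT /BadG /Small /Large /Middle.
    rewrite [(5 * H ^ _ <= G)%N]leqNgt [(G <= 5 * f n)%N]leqNgt.
    rewrite [(G ^ _ <= _)%N]leqNgt [(H ^ _ <= 5 * f n)%N]leqNgt eqn0Ngt.
    case: (0 < n)%N => //; case: (5 * f n < G)%N => //.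
    case: (5 * f n < H ^ (2 ^ n))%N => //; case: (G < 5 * H ^ (q * 2 ^ n))%N => //.
    by case: (H ^ (2 ^ n) < G ^ (C * q ^ 2))%N.
  move: (nat_of_bool (Zero n)) (nat_of_bool (BadT n)) (nat_of_bool (BadG n)).
  move: (nat_of_bool (Small n)) (nat_of_bool (Large n)) (nat_of_bool (Middle n)).
  move: (count Zero Y) (count BadT Y) (count BadG Y).
  move: (count Small Y) (count Large Y) (count Middle Y).
  by clear; lia.
have countZero : (count Zero X <= 1)%N.
  rewrite -size_filter; apply: size_le1 => [|n m]; first exact: filter_uniq.
  by rewrite !mem_filter => /andP[/eqP-> _] /andP[/eqP->].
have countBadT : (count BadT X <= 1)%N.
  rewrite -size_filter; apply: size_le1 => [|n m]; first exact: filter_uniq.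
  rewrite !mem_filter => /andP[/andP[n0 bad_n] _] /andP[/andP[_ bad_m] _] lt_nm.
  by apply: (archT n m); rewrite // n0.
have countBadG : (count BadG X <= 1)%N.
  rewrite -size_filter; apply: size_le1 => [|n m]; first exact: filter_uniq.
  rewrite !mem_filter => /andP[/andP[n0 bad_n] _] /andP[/andP[_ bad_m] _] lt_nm.
  by apply: (archG n m); rewrite // n0.
have countSmall : (count Small X <= 1 * size P)%N.
  (* Both indices are compared with [G]: the larger one bounds [H ^ (q 2 ^ m)] by [G / 5], and the
     smaller one has [G / 5 <= f n]. *)
  have small_f n m : Small n -> Small m -> (n <= m)%N -> (H ^ (q * 2 ^ m) <= f n)%N.
    move=> /and3P[_ _ le_Gf] /and3P[_ le_HG _] le_nm.
    by have := leq_trans le_HG le_Gf; rewrite leq_pmul2l.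
  have small_f1 n : Small n -> (1 < f n)%N.
    move=> sn; apply: leq_trans (small_f n n sn sn (leqnn n)).
    by rewrite H_gt1 // muln_gt0 expn_gt0.
  rewrite -size_filter; apply: (size_fibres (g := dp)) => [n|p].
    by rewrite mem_filter => /andP[/small_f1 f1 nX]; case: (dpP n nX f1).
  rewrite -filter_predI; apply: size_le1 => [|n m]; first exact: filter_uniq.
  rewrite !mem_filter => /andP[/andP[/= /eqP dn sn] nX].
  move=> /andP[/andP[/= /eqP dm sm] mX] lt_nm.
  have [_ p_pr le_n] := dpP n nX (small_f1 n sn).
  have [_ _ le_m] := dpP m mX (small_f1 m sm).
  rewrite dn in p_pr le_n; rewrite dm in le_m.
  have n0 : (0 < n)%N by case/and3P: sn.
  apply: (@small_pair a b c d p H n m) => //; first by rewrite n0.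
  - exact: dvdN n p.
  - exact: dvdN m p.
  - rewrite -(@leq_exp2r _ _ q) // -!expnM mulnC; apply: leq_trans le_n.
    exact: small_f (ltnW lt_nm).
  rewrite -(@leq_exp2r _ _ q) // -!expnM mulnC; apply: leq_trans le_m.
  exact: small_f.
have countLarge : (count Large X <= 2 * size P)%N.
  (* As [h = H ^ (2 ^ n) >= 25], the bound [f n >= h / 5] gives [f n ^ 2 >= h]. This square is the
     source of the exponent [2 q] in [large_triple]. *)
  have large_f n : Large n -> (H ^ (2 ^ n) <= f n ^ 2)%N.
    move=> /and3P[n0 le_GH le_Hf].
    have ge25 : (25 <= H ^ (2 ^ n))%N.
      apply: leq_trans le_GH; apply: (@leq_trans (2 ^ 5)) => //.
      apply: (@leq_trans (G ^ 5)); first by rewrite leq_exp2r.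
      rewrite leq_exp2l //; apply: (@leq_trans C) => //.
      by rewrite leq_pmulr // expn_gt0.
    have := leq_mul le_Hf le_Hf; move: ge25; set h := (H ^ _)%N; set x := f n.
    by clear; nia.
  have large_f1 n : Large n -> (1 < f n)%N.
    move=> ln; rewrite -(@ltn_exp2r _ _ 2) // exp1n; apply: leq_trans (large_f n ln).
    by rewrite H_gt1 // expn_gt0.
  rewrite -size_filter; apply: (size_fibres (g := dp)) => [n|p].
    by rewrite mem_filter => /andP[/large_f1 f1 nX]; case: (dpP n nX f1).
  rewrite -filter_predI; apply: size_le2 => [|n1 n2 n3]; first exact: filter_uniq.
  rewrite !mem_filter => /andP[/andP[/= /eqP d1 l1] X1].
  move=> /andP[/andP[/= /eqP d2 l2] X2] /andP[/andP[/= /eqP d3 l3] X3] lt_n.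
  have domH n : n \in X -> Large n -> dp n = p ->
      prime p /\ (H ^ (2 ^ n) <= p ^ (logn p (f n) * (2 * q)))%N.
    move=> nX ln dpE; have [_ p_pr le_f] := dpP n nX (large_f1 n ln).
    rewrite dpE in p_pr le_f; split=> //; apply: leq_trans (large_f n ln) _.
    by rewrite mulnCA [(2 * _)%N]mulnC expnM leq_exp2r.
  have [p_pr dom1] := domH _ X1 l1 d1.
  have [_ dom2] := domH _ X2 l2 d2.
  have [_ dom3] := domH _ X3 l3 d3.
  have GH : (G ^ (C * q ^ 2) <= H ^ (2 ^ n1))%N by case/and3P: l1.
  exact: (large_triple p_pr cop_ab cop_cd a0 b0 c0 d0 neq_ab neq_cd leaH lebH
    lecG ledG H2 G2 (ltn0Sn _) (leqnn C) lt_n (dvdN _ _) (dvdN _ _) (dvdN _ _)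
    dom1 dom2 dom3 GH).
have [t le_t countMiddle] : exists2 t, (2 ^ t <= 4096 * q ^ 3)%N &
    (count Middle X <= t.+1)%N.
  rewrite -size_filter.
  apply: size_window => [||n m]; [exact: filter_uniq | by rewrite muln_gt0 expn_gt0 |].
  rewrite !mem_filter => /andP[/and3P[n0 lt_GH _] _] /andP[/and3P[_ _ lt_HG] _].
  (* The factor 5 is absorbed by [H ^ 3 >= 8], and [3 + q 2 ^ n <= 4 q 2 ^ n]. Together with the
     factor 1024 this produces the constant 4096. *)
  have le_G : (G <= H ^ (4 * q * 2 ^ n))%N.
    apply: leq_trans (ltnW lt_GH) _; apply: (@leq_trans (H ^ 3 * H ^ (q * 2 ^ n))).
      rewrite leq_mul2r; apply/orP; right; apply: (@leq_trans (2 ^ 3)) => //.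
      by rewrite leq_exp2r.
    rewrite -expnD leq_exp2l //.
    have : (0 < q * 2 ^ n)%N by rewrite muln_gt0 expn_gt0.
    by rewrite -mulnA; set t := (q * _)%N; clear; lia.
  have : (H ^ (2 ^ m) < H ^ (4 * q * 2 ^ n * (C * q ^ 2)))%N.
    apply: leq_trans lt_HG _; rewrite [leqRHS]expnM.
    have Cq_gt0 : (0 < C * q ^ 2)%N by rewrite muln_gt0 expn_gt0.
    by rewrite leq_exp2r.
  rewrite ltn_exp2l // => /ltnW h; apply: leq_trans h _.
  by rewrite (_ : 4 * q * 2 ^ n * (C * q ^ 2) = 4096 * q ^ 3 * 2 ^ n)%N // /C; ring.
exists t => //.
move: cover countZero countBadT countBadG countSmall countLarge countMiddle.
move: (count Zero X) (count BadT X) (count BadG X).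
move: (count Small X) (count Large X) (count Middle X).
by clear; lia.
Qed.

Local Open Scope classical_set_scope.
Local Open Scope ring_scope.

(** * Reductions and orbits *)

Lemma intr_Fp_eq0 (p : nat) (x : int) : prime p ->
  (x%:~R == 0 :> 'F_p) = (p %| x)%Z.
Proof.
move=> p_pr; case: x => n; rewrite ?NegzE ?rmorphN /= ?oppr_eq0 -pmulrn;
  by rewrite -(dvdn_pcharf (pchar_Fp p_pr)) dvdzE ?abszN.
Qed.

(** A vanishing determinant makes the two coordinate vectors proportional modulo [p]; coprimality
    keeps both nonzero, so either both points are infinite or both are affine and equal. *)
Lemma homog_congr (p : nat) (a b c d : int) : prime p ->
  coprimez a b -> coprimez c d -> (p %| a * d - c * b)%Z ->
  homog (a%:~R : 'F_p) b%:~R = homog (c%:~R : 'F_p) d%:~R.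
Proof.
move=> p_pr cop_ab cop_cd p_det; rewrite /homog !intr_Fp_eq0 //.
have not_both := coprimez_prime_ndvd p_pr.
have [p_b|p_b] := boolP (p %| b)%Z.
  have p_a : ~~ (p %| a)%Z by apply: contraL p_b; apply: not_both.
  move: p_det; rewrite rpredBr; last by rewrite dvdz_mull.
  by rewrite Euclid_dvdz // (negbTE p_a) /= => ->.
have [p_d|p_d] := boolP (p %| d)%Z.
  have p_c : ~~ (p %| c)%Z by apply: contraL p_d; apply: not_both.
  move: p_det; rewrite rpredBl; last by rewrite dvdz_mull.
  by rewrite Euclid_dvdz // (negbTE p_b) (negbTE p_c).
congr (affine _); apply/eqP; rewrite eqr_div ?intr_Fp_eq0 //.
by rewrite -subr_eq0 -!rmorphM -rmorphB /= intr_Fp_eq0.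
Qed.

Lemma prim_coords_exp (x : rat) (n : nat) :
  prim_coords (affine (x ^+ n)) = (numq x ^+ n, denq x ^+ n).
Proof.
have xE : x ^+ n = (numq x ^+ n)%:~R / (denq x ^+ n)%:~R.
  by rewrite !rmorphXn /= -expr_div_n divq_num_den.
have cop : coprime `|numq x ^+ n| `|denq x ^+ n|.
  by rewrite !abszX coprimeXl // coprimeXr // coprime_num_den.
rewrite /= xE coprimeq_num // coprimeq_den // expf_eq0 denq_eq0 andbF.
by rewrite gtr0_sg ?exprn_gt0 // mul1r gtr0_norm // exprn_gt0.
Qed.

Lemma iter_sqmap (x : rat) (n : nat) :
  iter n sqmap (affine x) = affine (x ^+ (2 ^ n)).
Proof.
elim: n => [|n IHn]; first by rewrite expr1.
by rewrite iterS IHn /= -exprM mulnC -expnS.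
Qed.

Lemma reduction_orbit_eq (p n : nat) (x y : rat) : prime p ->
  (p %| numq x ^+ (2 ^ n) * denq y - numq y * denq x ^+ (2 ^ n))%Z ->
  reduction p (iter n sqmap (affine x)) = reduction p (affine y).
Proof.
move=> p_pr p_det; rewrite iter_sqmap /reduction prim_coords_exp.
apply: homog_congr => //; last by rewrite coprimezE coprime_num_den.
by rewrite coprimezXl // coprimezXr // coprimezE coprime_num_den.
Qed.

Lemma preperiodic_sq_fixed (x : rat) : x ^+ 2 * x ^+ 2 = x ^+ 2 ->
  preperiodic sqmap (affine x).
Proof.
move=> fix_x; apply: (@sub_finite_set _ _ [set affine x; affine (x ^+ 2)]).
  move=> _ [n _ <-]; case: n => [|n]; first by left.
  right; elim: n => [|n IHn] //; rewrite iterS IHn /=.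
  by congr (affine _); rewrite expr2.
exact: finite_set2.
Qed.

(** The excluded cases are [x = 0] and [x = 1] or [-1], whose squares are fixed by squaring. *)
Lemma not_preperiodic_coords (x : rat) : ~ preperiodic sqmap (affine x) ->
  numq x != 0 /\ `|numq x| != `|denq x|.
Proof.
move=> npx; split; apply/negP => /eqP h; apply: npx; apply: preperiodic_sq_fixed.
  by move/eqP: h; rewrite numq_eq0 => /eqP ->; rewrite expr0n mul0r.
suff -> : x ^+ 2 = 1 by rewrite mulr1.
have sqE : numq x ^+ 2 = denq x ^+ 2.
  by rewrite -[LHS]real_normK ?num_real // h real_normK ?num_real.
rewrite -[x]divq_num_den expr_div_n.
have := congr1 (intr : int -> rat) sqE; rewrite !rmorphXn /= => ->.
by rewrite divff // expf_neq0 // intr_eq0 denq_eq0.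
Qed.

(** * The primes of S and the final estimate *)

Definition finite_primes (S : {fset place}) : seq nat :=
  pmap (omap val) (enum_fset S).

Lemma mem_finite_primes (S : {fset place}) (p : {p : nat | prime p}) :
  finite_place p \in S -> val p \in finite_primes S.
Proof.
by move=> pS; rewrite mem_pmap; apply/mapP; exists (finite_place p).
Qed.

(** [pmap] drops the archimedean place, which accounts for the successor. *)
Lemma size_finite_primes (S : {fset place}) : archimedean \in S ->
  ((size (finite_primes S)).+1 <= #|` S|)%N.
Proof.
move=> arch; rewrite size_pmap -(count_predC (fun x : place => isSome (omap val x))).
rewrite -addn1 leq_add //= -has_count; apply/hasP.
by exists archimedean.
Qed.

Lemma log2_le (R : realType) (t q : nat) : (0 < q)%N ->
  (2 ^ t <= 4096 * q ^ 3)%N -> t%:R <= 12 + 3 * log2 (q%:R : R).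
Proof.
move=> q0 le_t; have ln2 : 0 < ln 2 :> R by rewrite ln_gt0 // ltr1n.
rewrite /log2 mulrA -(ler_pM2r ln2) mulrDl divfK ?gt_eqF //.
have q_pos : 0 < q%:R :> R by rewrite ltr0n.
have : (2 ^+ t : R) <= 2 ^+ 12 * q%:R ^+ 3.
  by rewrite -!natrX -natrM ler_nat.
rewrite -ler_ln ?posrE ?mulr_gt0 ?exprn_gt0 //.
by rewrite lnM ?posrE ?exprn_gt0 // !lnXn // !mulr_natl.
Qed.

Theorem theorem8p3 (R : realType) (S : {fset place}) (alpha beta : rat) :
  archimedean \in S ->
  ~ preperiodic sqmap (affine alpha) ->
  ~ preperiodic sqmap (affine beta) ->
  let A := [set n : nat |
              S_integral S (iter n sqmap (affine alpha)) (affine beta)] in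
  finite_set A /\
  (#|` fset_set A|%:R : R) <=
    3 * (#|` S|%:R : R) + 12 * log2 (#|` S|%:R : R) + 50.
Proof.
move=> arch np_al np_be A.
have [a0 neq_ab] := not_preperiodic_coords np_al.
have [c0 neq_cd] := not_preperiodic_coords np_be.
set P := finite_primes S.
pose N n := numq alpha ^+ (2 ^ n) * denq beta - numq beta * denq alpha ^+ (2 ^ n).
have NP n p : A n -> prime p -> (p %| N n)%Z -> p \in P.
  move=> An p_pr p_N; apply: contraT => pP.
  have pS : finite_place (exist _ p p_pr) \notin S.
    by apply: contra pP => /mem_finite_primes.
  by have /eqP := An _ pS; case; apply: reduction_orbit_eq.
(* If [N n] were 0, every prime would divide it, including one larger than all elements of [P]. *)
have N0 n : A n -> N n != 0.
  move=> An; apply/eqP => Nn0.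
  have [p lt_p p_pr] := prime_above (\max_(r <- P) r).
  have := NP n p An p_pr; rewrite Nn0 dvdz0 => /(_ isT) pP.
  by move: lt_p; rewrite ltnNge (@leq_bigmax_seq _ _ xpredT id).
(* The exponent from [core_bound] depends on the list; the truncated logarithm replaces it by a
   bound [B] uniform over all finite subsets of [A], which also gives finiteness. *)
pose t := trunc_log 2 (4096 * (size P).+1 ^ 3); pose B := (3 * size P + t + 4)%N.
have size_le (X : {fset nat}) : [set` X] `<=` A -> (#|` X| <= B)%N.
  move=> XA.
  have [u le_u le_X] := core_bound (coprime_num_den alpha) (coprime_num_den beta)
    a0 (denq_neq0 alpha) c0 (denq_neq0 beta) neq_ab neq_cd (fset_uniq X)
    (fun n nX => N0 n (XA n nX)) (fun n p nX => NP n p (XA n nX)).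
  apply: leq_trans le_X _; by rewrite leq_add2r leq_add2l; apply: trunc_log_max.
have finA : finite_set A.
  apply: contrapT => infA.
  have [X XA] := infinite_set_fset B.+1 infA.
  by rewrite ltnNge size_le.
split=> //.
have le_A : (#|` fset_set A| <= B)%N.
  by apply: size_le => n /=; rewrite in_fset_set // inE.
have le_S := size_finite_primes arch; rewrite -/P in le_S.
set q := #|` S| in le_S *.
have le_t : (2 ^ t <= 4096 * q ^ 3)%N.
  apply: (@leq_trans (4096 * (size P).+1 ^ 3)).
    by rewrite trunc_logP // muln_gt0 expn_gt0.
  by rewrite leq_mul2l leq_exp2r // le_S orbT.
have q_gt0 : (0 < q)%N by apply: leq_trans le_S.
have le_log := @log2_le R t q q_gt0 le_t.
have log_ge0 : 0 <= log2 (q%:R : R).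
  by rewrite divr_ge0 // ln_ge0 // ler1n.
(* By [le_log] this is at most [3 q + 3 log2 q + 16], and the logarithm is nonnegative. *)
apply: (@le_trans _ _ (3 * q%:R + t%:R + 4)).
  rewrite -!natrM -!natrD ler_nat; apply: leq_trans le_A _.
  by rewrite /B leq_add2r leq_add2r leq_mul2l ltnW ?orbT.
lra.
Qed.
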